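(* Let $\lambda\in[0,1]$. Every symmetric positive finite measure $G$ on the real line is the Lévy measure of a $\boxplus_\lambda$-infinitely divisible distribution; that is, for every such $G$ there exists a $\boxplus_\lambda$-infinitely divisible symmetric probability measure $\mu$ whose rectangular $R$-transform with ratio $\lambda$ is $$C_\mu(z)=z\int_{\mathbb{R}}\frac{1+t^2}{1-zt^2}\,dG(t).$$
   Context: A measure on $\mathbb{R}$ is symmetric if it is invariant under $t\mapsto -t$. Rectangular $R$-transform with ratio $\lambda\in[0,1]$. Let $z\mapsto\sqrt z$ be the analytic square root on $\mathbb{C}\setminus[0,+\infty)$ with $\sqrt{-1}=i$, and $z\mapsto z^{1/2}$ the analytic square root on $\mathbb{C}\setminus(-\infty,0]$ with $1^{1/2}=1$; $\arg$ takes values in $[0,2\pi)$. For $\alpha\in(0,\pi)$, $\beta>0$ let $\Delta_{\alpha,\beta}=\{z: |\arg z-\pi|<\alpha,\ 0<|z|<\beta\}$. For a symmetric probability measure $\mu$ let $G_\mu(z)=\int\frac{d\mu(t)}{z-t}$ and, for $z\in\mathbb{C}\setminus[0,+\infty)$, $H_\mu(z)=\lambda\, G_\mu(1/\sqrt z)^2+(1-\lambda)\sqrt z\,G_\mu(1/\sqrt z)$. There is a (unique germ of) analytic function $H_\mu^{-1}$, defined for every $\alpha\in(0,\pi)$ on $\Delta_{\alpha,\beta}$ for some $\beta>0$, with $H_\mu^{-1}(z)/z\to1$ as $z\to0$ in $\{|\arg z-\pi|<\alpha\}$ and $H_\mu\circ H_\mu^{-1}=H_\mu^{-1}\circ H_\mu=\mathrm{id}$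 on such a $\Delta_{\alpha,\beta}$. Near $0$ let $U(z)=\frac{-\lambda-1+[(\lambda+1)^2+4\lambda z]^{1/2}}{2\lambda}$ ($U(z)=z$ if $\lambda=0$). Then $C_\mu(z)=U\!\left(\frac{z}{H_\mu^{-1}(z)}-1\right)$, which for every $\alpha\in(0,\pi)$ is defined on $\Delta_{\alpha,\beta}$ for some $\beta>0$. The map $\mu\mapsto C_\mu$ is injective. Rectangular free convolution $\boxplus_\lambda$: for symmetric probability measures $\mu,\nu$, let $M(n),N(n)$ be independent $q_1(n)\times q_2(n)$ complex random matrices with $q_1(n),q_2(n)\to\infty$, $q_1(n)/q_2(n)\to\lambda$, one of them having a distribution invariant under left and right multiplication by unitary matrices, whose symmetrized singular laws (the symmetrization of the uniform law on the spectrum of $(MM^* )^{1/2}$) converge weakly in probability to $\mu$ and $\nu$; then the symmetrized singular law of $M(n)+N(n)$ converges weakly in probability to $\mu\boxplus_\lambda\nu$. Equivalently, $\mu\boxplus_\lambda\nu$ is the unique symmetric probability measure with $C_{\mu\boxplus_\lambda\nu}=C_\mu+C_\nu$. A symmetric probability measure $\nu$ is $\boxplus_\lambda$-infinitely divisible if for each $n\ge1$ there is a symmetric probability measure $\nu_n$ with $\nu_n^{\boxplus_\lambda n}=\nu$ ($n$-fold $\boxplus_\lambda$-power). The Lévy measure of a $\boxplus_\lambda$-infinitely divisible distribution $\mu$ is the unique symmetric positive finite measure $G$ on $\mathbb{R}$ with $C_\mu(z)=z\int_{\mathbb{R}}\frac{1+t^2}{1-zt^2}\,dG(t)$. *)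

(* Defs.v *)
From HB Require Import structures.
From mathcomp Require Import all_boot all_order all_algebra.
From mathcomp Require Import complex.
From mathcomp Require Import all_classical all_reals all_analysis.
Set Implicit Arguments.
Unset Strict Implicit.
Unset Printing Implicit Defensive.
Import Order.TTheory GRing.Theory Num.Theory.
Import numFieldNormedType.Exports.
Local Open Scope classical_set_scope.
Local Open Scope ring_scope.
Local Open Scope complex_scope.

Section ComplexPlane.
Variable R : realType.
Local Notation C := R[i].

Definition cmod (z : C) : R := complex.Re `|z|.

(* The argument in [0, 2 pi); only meaningful for z != 0. *)
Definition arg (z : C) : R :=
  let a := acos (complex.Re z / cmod z) in
  if 0 <= complex.Im z then a else 2 * pi - a.

(* [sqrtc] is the principal root (nonnegative real part), so [sqrt_pos] is the
   analytic root off (-oo, 0] with value 1 at 1, and [sqrt_neg] the analytic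
   root off [0, +oo) with value 'i at -1. *)
Definition sqrt_pos (z : C) : C := sqrtc z.
Definition sqrt_neg (z : C) : C := 'i * sqrtc (- z).

Definition sector (alpha : R) : set C :=
  [set z | z != 0 /\ `|arg z - pi| < alpha].

Definition Delta (alpha beta : R) : set C :=
  [set z | `|arg z - pi| < alpha /\ 0 < cmod z < beta].

(* "For every alpha in (0, pi), P holds on Delta_{alpha, beta} for some
   beta > 0": the sense in which all germs at 0 below are considered. *)
Definition near0_sectors (P : C -> Prop) : Prop :=
  forall alpha : R, 0 < alpha < pi ->
    exists2 beta : R, 0 < beta & forall z, Delta alpha beta z -> P z.

Definition germ_eq (f g : C -> C) : Prop := near0_sectors (fun z => f z = g z).

(* Complex differentiability: [R[i]^o] is normed over the field [R[i]]. *)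
Definition cdifferentiable (f : C -> C) (z : C) : Prop :=
  derivable (f : C^o -> C^o) z 1.

End ComplexPlane.

Section RectangularRTransform.
Variable R : realType.
Local Notation C := R[i].
Local Notation RB := (measurableTypeR R).

Definition symmetric_measure (mu : {measure set RB -> \bar R}) : Prop :=
  forall A : set RB, measurable A -> mu ((fun t : R => - t) @^-1` A) = mu A.

Definition cintegral (mu : {measure set RB -> \bar R}) (f : R -> C) : C :=
  (\int[mu]_(t in [set: RB]) complex.Re (f t))%R
  +i* (\int[mu]_(t in [set: RB]) complex.Im (f t))%R.

Definition cauchyG (mu : {measure set RB -> \bar R}) (z : C) : C :=
  cintegral mu (fun t => (z - t%:C)^-1).

Definition rectH (lambda : R) (mu : {measure set RB -> \bar R}) (z : C) : C :=
  lambda%:C * (cauchyG mu ((sqrt_neg z)^-1)) ^+ 2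
  + (1 - lambda)%:C * sqrt_neg z * cauchyG mu ((sqrt_neg z)^-1).

(* [h] is a total function representing the germ of the inverse of
   [rectH lambda mu]; its values away from the sectors Delta are irrelevant. *)
Definition is_rectHinv (lambda : R) (mu : {measure set RB -> \bar R})
    (h : C -> C) : Prop :=
  [/\ near0_sectors (cdifferentiable h),
      forall alpha : R, 0 < alpha < pi ->
        (fun z : C^o => (h z / z : C^o))
          @ within (sector alpha) (nbhs (0 : C^o)) --> (1 : C^o),
      near0_sectors (fun z => rectH lambda mu (h z) = z)
    & near0_sectors (fun z => h (rectH lambda mu z) = z)].

(* A representative of the germ, which exists and is unique up to [germ_eq]
   when [mu] is a symmetric probability measure. *)
Definition rectHinv (lambda : R) (mu : {measure set RB -> \bar R}) : C -> C :=
  xget (fun=> 0) [set h | is_rectHinv lambda mu h].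

Definition rectU (lambda : R) (z : C) : C :=
  if lambda == 0 then z else
  (- lambda%:C - 1 + sqrt_pos ((lambda%:C + 1) ^+ 2 + 4 * lambda%:C * z))
    / (2 * lambda%:C).

(* The rectangular R-transform C_mu with ratio lambda; it is only a germ, to be
   compared by means of [germ_eq]. *)
Definition rectC (lambda : R) (mu : {measure set RB -> \bar R}) (z : C) : C :=
  rectU lambda (z / rectHinv lambda mu z - 1).

(* [rho] is the rectangular free convolution of [mu] and [nu]: the symmetric
   probability measure with C_rho = C_mu + C_nu, which is unique because a
   symmetric probability measure is determined by the germ of its transform. *)
Definition is_rect_conv (lambda : R) (mu nu rho : probability RB R) : Prop :=
  [/\ symmetric_measure mu, symmetric_measure nu, symmetric_measure rho
    & germ_eq (rectC lambda rho)
              (fun z => rectC lambda mu z + rectC lambda nu z)].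

(* [is_rect_conv_pow lambda mu n rho]: [rho] is the n-fold power of [mu],
   n >= 1. *)
Inductive is_rect_conv_pow (lambda : R) (mu : probability RB R) :
    nat -> probability RB R -> Prop :=
| rect_conv_pow1 : is_rect_conv_pow lambda mu 1%N mu
| rect_conv_powS (n : nat) (rho sigma : probability RB R) :
    is_rect_conv_pow lambda mu n rho ->
    is_rect_conv lambda rho mu sigma ->
    is_rect_conv_pow lambda mu n.+1 sigma.

Definition rect_infinitely_divisible (lambda : R) (nu : probability RB R) :
    Prop :=
  symmetric_measure nu /\
  forall n : nat, (1 <= n)%N ->
    exists nu_n : probability RB R,
      symmetric_measure nu_n /\ is_rect_conv_pow lambda nu_n n nu.

Definition levyC (G : {measure set RB -> \bar R}) (z : C) : C :=
  z * cintegral G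
        (fun t => (1 + t ^+ 2)%:C / (1 - z * (t ^+ 2)%:C)).

Definition is_levy_measure (lambda : R) (mu : probability RB R)
    (G : {finite_measure set RB -> \bar R}) : Prop :=
  symmetric_measure G /\ germ_eq (rectC lambda mu) (levyC G).

End RectangularRTransform.

(* Main.v *)
(* Put m(z) = \int dmu(t) / (1 - z t^2) and C(w) = w D(w). With
   mtilde = lambda m + 1 - lambda, one has H_mu(z) = z m(z) mtilde(z), and
   C_mu = C amounts to C(H_mu) = m - 1, that is to the fixed-point equation
     m = 1 / (1 - z mtilde D(z m mtilde)).
   In a cone around the negative half-line and for |z| small, the right-hand
   side is a contraction in m, so its fixed point there is unique and is the
   limit of the iterates started at 1. When G has finite support, each iterate,
   in the variable u with z = u^(-2), is up to a factor u a diagonal entry of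
   the resolvent of a Hermitian matrix: such functions are stable under sums,
   positive multiples, g |-> 1 / (u - g) (bordering the matrix) and
   (g1, g2) |-> g1 / (1 - k g1 g2) (a rank-two coupling). By the spectral theorem
   the iterate is then the transform of a finitely supported law of t^2. In the
   variable theta = 1 / (1 + t^2), which lives in the compact [0, 1], these laws
   are given by nondecreasing quantile functions, and a pointwise ultrafilter
   limit of them has the fixed point as transform; it has no mass at infinity
   (theta = 0) because m(-r) tends to 1 as r tends to 0. The inverse of H_mu is
   h(w) = w / ((1 + C(w)) (1 + lambda C(w))), and U recovers C from w / h(w) - 1.
   Infinite divisibility follows by applying existence to the multiples
   (j / n) G. *)
From HB Require Import structures.
Require Import Defs.
From mathcomp Require Import all_boot all_order all_algebra.
From mathcomp Require Import complex ring lra.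
From mathcomp Require Import all_classical all_reals all_analysis.
From mathcomp Require Import measurable_realfun.
Import Order.TTheory GRing.Theory Num.Theory.
Import numFieldNormedType.Exports.
Import HBNNSimple.
Set Implicit Arguments.
Unset Strict Implicit.
Unset Printing Implicit Defensive.
Local Open Scope classical_set_scope.
Local Open Scope ring_scope.

(** * Resolvents of Hermitian matrices *)

Section Resolvents.
Local Open Scope sesquilinear_scope.
Variable C : numClosedFieldType.

(** The contraction argument alone does not show that its solution is the transform of a positive
    measure; the matrices are there to keep positivity visible at every step. Finite support is
    obtained by replacing t^2, and not G, by simple functions below it. All estimates are then
    uniform, with the single quantity kappa(|z|), and the n-th iterate can be taken with the n-th
    simple function because the contraction rate 1/2 is the same for all of them. One law must serve
    all z, so the limit is taken before z is chosen. In general a pointwise limit along an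
    ultrafilter loses measurability and dominated convergence; monotonicity of quantile functions
    restores both, since Riemann sums of f o Q converge at a rate depending only on the Lipschitz
    constant of f. Constants: for m within c/6 of 1, m mtilde is within c/2 of 1, so z m mtilde
    keeps cone constant c/2. There z mtilde D(z m mtilde) is bounded by 32 kappa / c^2 and Lipschitz
    in m with the same constant; requiring this to be at most c/12 makes the step preserve the disc
    and contract by 1/2. *)

Lemma adjmxM m n p (A : 'M[C]_(m, n)) (B : 'M[C]_(n, p)) :
  (A *m B)^t* = B^t* *m A^t*.
Proof. by rewrite trmx_mul map_mxM. Qed.

Lemma scalar_mx1_inj : injective (@scalar_mx C 1).
Proof. by move=> a b /matrixP/(_ 0 0); rewrite !mxE !mulr1n. Qed.

Lemma hermitian_decomposition d (A : 'M[C]_d) : A^t* = A ->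
  exists P : 'M[C]_d, exists2 D : 'rV[C]_d, (forall j, D 0 j \is Num.real) &
    P \is unitarymx /\ A = invmx P *m diag_mx D *m P.
Proof.
move=> Ah; have Aherm : A \is hermsymmx.
  by apply/is_hermitianmxP; rewrite expr0 scale1r Ah.
exists (spectralmx A), (spectral_diag A); last first.
  split; first exact: spectral_unitarymx.
  exact/orthomx_spectralP/hermitian_normalmx.
by move=> j; exact: (mxOverP (hermitian_spectral_diag_real Aherm)).
Qed.

(** The eigenvalues of [A] are real, so none of them equals [u]. *)
Lemma herm_sub_unit d (A : 'M[C]_d) (u : C) :
  A^t* = A -> u \isn't Num.real -> u%:M - A \in unitmx.
Proof.
move=> /hermitian_decomposition[P [D Dr [Pu ->]]] ur.
have Pi := unitarymx_unit Pu.
have -> : u%:M - invmx P *m diag_mx D *m P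
        = invmx P *m diag_mx (\row_j (u - D 0 j)) *m P.
  have -> : diag_mx (\row_j (u - D 0 j)) = u%:M - diag_mx D.
    apply/matrixP => i j; rewrite !mxE.
    by case: eqP => _; rewrite ?mulr1n ?mulr0n ?subr0.
  by rewrite mulmxBr mulmxBl mul_mx_scalar -scalemxAl mulVmx// scalemx1.
rewrite !unitmx_mul unitmx_inv Pi /= andbT unitmxE det_diag unitfE.
apply/prodf_neq0 => j _; rewrite mxE subr_eq0.
by apply: contraNneq ur => ->; exact: Dr.
Qed.

(* A diagonal entry of the resolvent of a Hermitian matrix is the Cauchy
   transform of a finitely supported measure, here of total mass [c]. *)
Definition resolvent_entry (c : C) (g : C -> C) : Prop :=
  exists d (A : 'M[C]_d) (v : 'cV[C]_d),
    [/\ A^t* = A, v^t* *m v = c%:M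
      & forall u, u \isn't Num.real ->
        v^t* *m (invmx (u%:M - A) *m v) = (g u)%:M].

(** Block matrices are handled below one block row at a time. Each row is an equation (u - A) x = a
    v, where the scalar a carries the influence of the other block, and pairing its solution with v
    yields a g(u). *)
Lemma resolvent_entry_lin d (A : 'M[C]_d) (v x : 'cV[C]_d) (g : C -> C)
    (u a : C) : A^t* = A -> u \isn't Num.real ->
    v^t* *m (invmx (u%:M - A) *m v) = (g u)%:M ->
    u *: x - A *m x = a *: v -> v^t* *m x = (a * g u)%:M.
Proof.
move=> Ah ur vg /(congr1 (mulmx (invmx (u%:M - A)))).
rewrite -mul_scalar_mx -mulmxBl mulKmx ?herm_sub_unit// => ->.
by rewrite -!scalemxAr vg scale_scalar_mx.
Qed.

Lemma resolvent_solve d (A : 'M[C]_d) (v : 'cV[C]_d) (u : C) :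
  A^t* = A -> u \isn't Num.real ->
  u *: (invmx (u%:M - A) *m v) - A *m (invmx (u%:M - A) *m v) = v.
Proof.
move=> Ah ur.
by rewrite -mul_scalar_mx -mulmxBl mulKVmx ?herm_sub_unit.
Qed.

(** In an orthonormal eigenbasis the weights are the squared moduli of the coordinates of [v]. *)
Lemma resolvent_entry_discrete c g : resolvent_entry c g ->
  exists d (p a : 'I_d -> C),
    [/\ forall j, 0 <= p j, forall j, a j \is Num.real, \sum_j p j = c
      & forall u, u \isn't Num.real -> g u = \sum_j p j / (u - a j)].
Proof.
case=> d [A [v [Ah vc gE]]].
have [P [D Dr [Pu AE]]] := hermitian_decomposition Ah.
have Pi := unitarymx_unit Pu.
pose w := P *m v.
have vE : v = P^t* *m w by rewrite -invmx_unitary// mulKmx.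
exists d, (fun j => w j 0 * (w j 0)^*), (fun j => D 0 j); split.
- by move=> j; exact: mul_conjC_ge0.
- exact: Dr.
- apply/scalar_mx1_inj; rewrite -vc; apply/matrixP => i j.
  rewrite !ord1 [LHS]mxE mulr1n vE adjmxM trmxCK mulmxA mulmxtVK// mxE.
  by apply: eq_bigr => k _; rewrite !mxE mulrC.
move=> u ur; apply/scalar_mx1_inj; rewrite -gE//.
pose y := \col_j (w j 0 / (u - D 0 j)).
have -> : invmx (u%:M - A) *m v = P^t* *m y.
  apply: (can_inj (mulKmx (herm_sub_unit Ah ur))).
  rewrite mulKVmx ?herm_sub_unit// mulmxBl mul_scalar_mx AE -invmx_unitary//.
  rewrite -!mulmxA mulKVmx// scalemxAr -mulmxBr vE -invmx_unitary//.
  congr (_ *m _); apply/matrixP => i j; rewrite ord1 mul_diag_mx !mxE -mulrBl.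
  rewrite mulrC divfK// subr_eq0; apply: contraNneq ur => ->; exact: Dr.
rewrite vE adjmxM trmxCK mulmxA mulmxtVK//; apply/matrixP => i j.
rewrite !ord1 !mxE mulr1n; apply: eq_bigr => k _.
by rewrite !mxE mulrCA mulrA.
Qed.

Lemma resolvent_entry_ext c g g' : (forall u, u \isn't Num.real -> g u = g' u) ->
  resolvent_entry c g -> resolvent_entry c g'.
Proof.
move=> gg' [d [A [v [Ah vc gE]]]]; exists d, A, v; split => // u ur.
by rewrite gE// gg'.
Qed.

Lemma resolvent_entry0 : resolvent_entry 0 (fun=> 0).
Proof.
exists 0%N, 0, 0; split; first by apply/matrixP=> -[].
  by rewrite mulmx0 raddf0.
by move=> u _; rewrite !mulmx0 raddf0.
Qed.

Lemma resolvent_entryD c1 c2 g1 g2 :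
  resolvent_entry c1 g1 -> resolvent_entry c2 g2 ->
  resolvent_entry (c1 + c2) (fun u => g1 u + g2 u).
Proof.
move=> [d1 [A1 [v1 [h1 n1 E1]]]] [d2 [A2 [v2 [h2 n2 E2]]]].
pose A := block_mx A1 0 0 A2; pose v := col_mx v1 v2.
have Ah : A^t* = A.
  by rewrite /A tr_block_mx map_block_mx !trmx0 !map_mx0 h1 h2.
exists (d1 + d2)%N, A, v; split => //.
  by rewrite /v tr_col_mx map_row_mx mul_row_col n1 n2 -raddfD.
move=> u ur; have := resolvent_solve v Ah ur.
move: (invmx _ *m v) => x; rewrite -[x]vsubmxK.
rewrite /A /v mul_block_col !mul0mx addr0 add0r scale_col_mx opp_col_mx.
rewrite add_col_mx => /eq_col_mx[].
rewrite -[X in _ = X -> _]scale1r => e1.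
rewrite -[X in _ = X -> _]scale1r => e2.
rewrite tr_col_mx map_row_mx mul_row_col.
rewrite (resolvent_entry_lin h1 ur (E1 _ ur) e1).
by rewrite (resolvent_entry_lin h2 ur (E2 _ ur) e2) !mul1r -raddfD.
Qed.

Lemma resolvent_entryZ k c g : 0 <= k -> resolvent_entry c g ->
  resolvent_entry (k * c) (fun u => k * g u).
Proof.
move=> k0 [d [A [v [Ah vc gE]]]]; exists d, A, (sqrtC k *: v).
have kE : (sqrtC k)^* * sqrtC k = k.
  by rewrite conj_Creal ?ger0_real ?sqrtC_ge0// -expr2 sqrtCK.
have adjZ : (sqrtC k *: v)^t* = (sqrtC k)^* *: v^t*.
  by rewrite linearZ /= map_mxZ.
split => //.
  by rewrite adjZ -scalemxAl -scalemxAr scalerA kE vc scale_scalar_mx.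
move=> u ur; rewrite adjZ -scalemxAl -!scalemxAr scalerA kE gE//.
by rewrite scale_scalar_mx.
Qed.

(** A Schur complement: one row and column are added, with corner 0 and off-diagonal part [v]. If xi
    is the new coordinate of the solution, the old rows give xi (u - A)^-1 v for the others, and the
    new row becomes xi (u - g) = 1. *)
Lemma resolvent_entry_border c g : resolvent_entry c g ->
  resolvent_entry 1 (fun u => (u - g u)^-1).
Proof.
move=> [d [A [v [Ah vc gE]]]].
pose B := block_mx (0 : 'M[C]_1) (v^t*) v A : 'M[C]_(1 + d).
pose e := col_mx 1%:M 0 : 'cV[C]_(1 + d).
have Bh : B^t* = B.
  by rewrite /B tr_block_mx map_block_mx trmx0 map_mx0 Ah trmxCK.
exists (1 + d)%N, B, e; split => //.
  rewrite /e tr_col_mx map_row_mx mul_row_col mulmx0 addr0.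
  by rewrite mulmx1 trmx1 map_mx1.
move=> u ur; have := resolvent_solve e Bh ur.
move: (invmx _ *m e) => x; rewrite -[x]vsubmxK.
have [xi xiE] : exists a, usubmx x = a%:M :> 'M[C]_1.
  by exists (usubmx x 0 0); apply/matrixP=> i j; rewrite !ord1 [RHS]mxE mulr1n.
rewrite /B /e mul_block_col mul0mx add0r scale_col_mx opp_col_mx.
rewrite add_col_mx => /eq_col_mx[]; rewrite xiE mul_mx_scalar => e1.
move/eqP; rewrite opprD addrCA addrC subr_eq0 => /eqP e2.
rewrite tr_col_mx map_row_mx mul_row_col trmx1 map_mx1 mul1mx trmx0 map_mx0.
rewrite mul0mx addr0; congr (_%:M).
move: e1; rewrite (resolvent_entry_lin Ah ur (gE _ ur) e2).
rewrite scale_scalar_mx -raddfB mulrC -mulrBr => /scalar_mx1_inj e1.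
(* The equation [e1] itself forbids [u - g u] to vanish. *)
have u0 : u - g u != 0.
  by apply: contra_eq_neq e1 => ->; rewrite mulr0 eq_sym oner_eq0.
by apply: (mulIf u0); rewrite e1 mulVf.
Qed.

Lemma resolvent_entry_inv : resolvent_entry 1 (fun u => u^-1).
Proof.
apply: resolvent_entry_ext (resolvent_entry_border resolvent_entry0) => u _.
by rewrite subr0.
Qed.

(** The off-diagonal blocks are t v1 v2^* and its adjoint, with t^2 = k. With al and be the pairings
    of v1, v2 with the two halves of the solution, the rows say al = (1 + t be) g1 and be = t al g2;
    eliminating be leaves al (1 - k g1 g2) = g1. *)
Lemma resolvent_entry_couple k c1 c2 g1 g2 : 0 <= k ->
  resolvent_entry c1 g1 -> resolvent_entry c2 g2 ->
  resolvent_entry c1 (fun u => g1 u / (1 - k * g1 u * g2 u)).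
Proof.
move=> k0 [d1 [A1 [v1 [h1 n1 E1]]]] [d2 [A2 [v2 [h2 n2 E2]]]].
pose t := sqrtC k; have tr : t^* = t.
  by rewrite conj_Creal ?ger0_real ?sqrtC_ge0.
have tk : t * t = k by rewrite -expr2 sqrtCK.
pose A := block_mx A1 (t *: (v1 *m v2^t*)) (t *: (v2 *m v1^t*)) A2.
pose v := col_mx v1 (0 : 'cV_d2).
have Ah : A^t* = A.
  by rewrite /A tr_block_mx map_block_mx !linearZ /= !map_mxZ !adjmxM h1 h2 /= tr
             !trmxCK.
exists (d1 + d2)%N, A, v; split => //.
  by rewrite /v tr_col_mx map_row_mx mul_row_col mulmx0 addr0.
move=> u ur; have := resolvent_solve v Ah ur.
move: (invmx _ *m v) => x; rewrite -[x]vsubmxK.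
have [al alE] : exists a, v1^t* *m usubmx x = a%:M :> 'M[C]_1.
  by exists ((v1^t* *m usubmx x) 0 0); apply/matrixP=> i j;
    rewrite !ord1 [RHS]mxE mulr1n.
have [be beE] : exists a, v2^t* *m dsubmx x = a%:M :> 'M[C]_1.
  by exists ((v2^t* *m dsubmx x) 0 0); apply/matrixP=> i j;
    rewrite !ord1 [RHS]mxE mulr1n.
rewrite /A /v mul_block_col scale_col_mx opp_col_mx.
rewrite add_col_mx => /eq_col_mx[].
rewrite -!scalemxAl -!mulmxA alE beE !mul_mx_scalar !scalerA => e1 e2.
have {}e1 : u *: usubmx x - A1 *m usubmx x = (1 + t * be) *: v1.
  by rewrite scalerDl scale1r -{1}e1 opprD addrA subrK.
have {}e2 : u *: dsubmx x - A2 *m dsubmx x = (t * al) *: v2.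
  by move/eqP: e2; rewrite opprD addrCA addrC subr_eq0 => /eqP.
rewrite tr_col_mx map_row_mx mul_row_col trmx0 map_mx0 mul0mx addr0 alE.
congr (_%:M).
have := resolvent_entry_lin h1 ur (E1 _ ur) e1.
rewrite alE => /scalar_mx1_inj a1.
have := resolvent_entry_lin h2 ur (E2 _ ur) e2.
rewrite beE => /scalar_mx1_inj b1.
have a2 : al * (1 - k * g1 u * g2 u) = g1 u.
  by rewrite mulrBr mulr1 {1}a1 b1 -tk mulrDl mul1r; ring.
(* If this factor vanished, [a2] would give g1 = 0, and then the factor would be 1. *)
have k1 : 1 - k * g1 u * g2 u != 0.
  apply/eqP => k1; move: a2; rewrite k1 mulr0 => g10.
  by move/eqP: k1; rewrite -g10 mulr0 mul0r subr0 oner_eq0.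
by apply: (mulIf k1); rewrite a2 divfK.
Qed.

End Resolvents.

Local Open Scope complex_scope.

(** * Iterates of the fixed-point map for finitely supported data *)

Section FixpointStep.
Variable R : realType.
Local Notation C := R[i].

Definition mtilde (lambda : R) (m : C) : C := lambda%:C * m + (1 - lambda)%:C.

Definition fixstep (lambda : R) (D : C -> C) (z m : C) : C :=
  (1 - z * mtilde lambda m * D (z * m * mtilde lambda m))^-1.

(** A pair [x] stands for an atom of mass [x.1] at the point t^2 = [x.2]. *)
Definition atomicD (l : seq (R * R)) (w : C) : C :=
  \sum_(x <- l) (x.1 * (1 + x.2))%:C / (1 - w * x.2%:C).

Lemma resolvent_entry_sum (l : seq (R * R)) (g gt : C -> C) :
  (forall x, x \in l -> 0 <= x.1 /\ 0 <= x.2) ->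
  resolvent_entry 1 g -> resolvent_entry 1 gt ->
  exists c, resolvent_entry c (fun u => \sum_(x <- l) (x.1 * (1 + x.2))%:C *
    (gt u / (1 - x.2%:C * gt u * g u))).
Proof.
move=> lP gP gtP; elim: l lP => [|x l IH] lP.
  exists 0; apply: resolvent_entry_ext (resolvent_entry0 C) => u _.
  by rewrite big_nil.
have [|c cP] := IH; first by move=> y yl; apply: lP; rewrite inE yl orbT.
have [x1 x2] : 0 <= x.1 /\ 0 <= x.2 by apply: lP; rewrite mem_head.
exists ((x.1 * (1 + x.2))%:C * 1 + c).
apply: resolvent_entry_ext => [u _|]; first by rewrite big_cons.
apply: resolvent_entryD cP; apply: resolvent_entryZ.
  by rewrite ler0c mulr_ge0 ?addr_ge0.
by apply: resolvent_entry_couple gP => //; rewrite ler0c.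
Qed.

(** With g = m / u and gt = mtilde / u one has z m mtilde = g gt, and the next iterate divided by u
    is 1 / (u - gt D(g gt)). Each atom of D contributes a coupling of gt with g, and the outer
    inverse is a bordering. *)
Lemma resolvent_entry_fixstep (lambda : R) (l : seq (R * R)) (k : nat) :
  0 <= lambda <= 1 -> (forall x, x \in l -> 0 <= x.1 /\ 0 <= x.2) ->
  resolvent_entry (1 : C)
    (fun u => iter k (fixstep lambda (atomicD l) (u ^- 2)) 1 / u).
Proof.
move=> /andP[l0 l1] lP; elim: k => [|k IH].
  by apply: resolvent_entry_ext (resolvent_entry_inv C) => u _ /=; rewrite mul1r.
set m := fun u => iter k (fixstep lambda (atomicD l) (u ^- 2)) 1 in IH.
pose gt u : C := lambda%:C * (m u / u) + (1 - lambda)%:C * u^-1.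
have gtP : resolvent_entry 1 gt.
  have -> : (1 : C) = lambda%:C * 1 + (1 - lambda)%:C * 1.
    by rewrite !mulr1 -rmorphD /= addrC subrK.
  apply: resolvent_entryD; first by apply: resolvent_entryZ => //; rewrite ler0c.
  by apply: (resolvent_entryZ _ (resolvent_entry_inv C)); rewrite ler0c subr_ge0.
have [c XP] := resolvent_entry_sum lP IH gtP.
apply: resolvent_entry_ext (resolvent_entry_border XP) => u ur /=.
have u0 : u != 0 by apply: contraNneq ur => ->; exact: real0.
rewrite -/(m u) /fixstep -invfM; congr (_^-1).
rewrite mulrBl mul1r; congr (_ - _).
rewrite /atomicD mulr_sumr mulr_suml; apply: eq_bigr => x _.
have gtE : gt u = mtilde lambda (m u) / u.
  by rewrite /gt /mtilde mulrDl mulrA.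
have -> : u ^- 2 * m u * mtilde lambda (m u) * x.2%:C
        = x.2%:C * gt u * (m u / u).
  by rewrite gtE; field.
by rewrite gtE; set y := (1 - _)^-1; field.
Qed.

Lemma fixstep_discrete (lambda : R) (l : seq (R * R)) (k : nat) :
  0 <= lambda <= 1 -> (forall x, x \in l -> 0 <= x.1 /\ 0 <= x.2) ->
  exists d (p a : 'I_d -> R), [/\ forall j, 0 <= p j, \sum_j p j = 1
    & forall z : C, ~~ (0 <= z) -> iter k (fixstep lambda (atomicD l) z) 1
        = \sum_j (p j)%:C / (1 - z * (a j ^+ 2)%:C)].
Proof.
move=> hl lP.
have [d [p [a [p0 ar p1 gE]]]] :=
  resolvent_entry_discrete (resolvent_entry_fixstep k hl lP).
have pE j : p j = (complex.Re (p j))%:C by rewrite RRe_real// ger0_real.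
have aE j : a j = (complex.Re (a j))%:C by rewrite RRe_real.
exists d, (fun j => complex.Re (p j)), (fun j => complex.Re (a j));
  split => [j|| z z0] /=.
- by rewrite -ler0c -pE.
- by apply: complexI; rewrite rmorph_sum [RHS](_ : _ = 1)// -p1;
    apply: eq_bigr => j _; exact/esym/pE.
have zN0 : z != 0 by apply: contraNneq z0 => ->.
pose u := (sqrtc z)^-1.
have uz : u ^- 2 = z by rewrite /u exprVn invrK sqr_sqrtc.
have u0 : u != 0 by rewrite invr_eq0 sqrtc_eq0.
have ur : u \isn't Num.real.
  apply: contraNN z0 => ur; rewrite -uz -exprVn real_exprn_even_ge0//.
  by rewrite realV.
have /= e1 := gE _ ur.
have /= e2 := gE (- u) _.
rewrite sqrrN uz in e2; rewrite uz in e1; rewrite realN in e2.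
have {}e2 := e2 ur.
(* Both u and -u belong to the same z. The half-difference symmetrises the poles, since 1 / (u - a)
   + 1 / (u + a) = 2 u / (u^2 - a^2), so that only their squares remain. *)
have -> : iter k (fixstep lambda (atomicD l) z) 1 = u / 2 *
    (iter k (fixstep lambda (atomicD l) z) 1 / u -
     iter k (fixstep lambda (atomicD l) z) 1 / (- u)).
  by rewrite invrN mulrN opprK; field.
rewrite e1 e2 -sumrB mulr_sumr; apply: eq_bigr => j _.
rewrite -pE rmorphXn /= -aE -uz.
have h1 : u - a j != 0 by rewrite subr_eq0; apply: contraNneq ur => ->.
have h2 : - u - a j != 0.
  rewrite subr_eq0; apply: contraNneq ur => h.
  by rewrite -realN h.
have h3 : u ^+ 2 - a j ^+ 2 != 0.
  by rewrite subr_sqr mulf_neq0// -oppr_eq0 opprD.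
by field; rewrite h1 u0 h3 h2.
Qed.

End FixpointStep.

(** * Complex-valued integrals *)

Section ComplexModulus.
Variable R : realType.
Local Notation C := R[i].
Implicit Types z w : C.

Lemma cmodE z : cmod z = Num.sqrt (complex.Re z ^+ 2 + complex.Im z ^+ 2).
Proof. by rewrite /cmod normc_def. Qed.

Lemma normc_cmod z : `|z| = (cmod z)%:C.
Proof. by rewrite /cmod RRe_real// normr_real. Qed.

Lemma cmod_ge0 z : 0 <= cmod z.
Proof. by rewrite cmodE sqrtr_ge0. Qed.

Lemma cmod0 : cmod (0 : C) = 0.
Proof. by rewrite /cmod normr0. Qed.

Lemma cmod1 : cmod (1 : C) = 1.
Proof. by rewrite /cmod normr1. Qed.

Lemma cmod_eq0 z : (cmod z == 0) = (z == 0).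
Proof. by rewrite -(normr_eq0 z) normc_cmod -(inj_eq (@complexI R)). Qed.

Lemma cmod_gt0 z : (0 < cmod z) = (z != 0).
Proof. by rewrite lt_def cmod_ge0 andbT cmod_eq0. Qed.

Lemma cmodM z w : cmod (z * w) = cmod z * cmod w.
Proof. by apply: complexI; rewrite rmorphM /= -!normc_cmod normrM. Qed.

Lemma cmodV z : cmod z^-1 = (cmod z)^-1.
Proof. by apply: complexI; rewrite fmorphV /= -!normc_cmod normfV. Qed.

Lemma cmodN z : cmod (- z) = cmod z.
Proof. by rewrite /cmod normrN. Qed.

Lemma cmod_distC z w : cmod (z - w) = cmod (w - z).
Proof. by rewrite -cmodN opprB. Qed.

Lemma cmodR (x : R) : cmod x%:C = `|x|.
Proof. by rewrite cmodE /= expr0n addr0 sqrtr_sqr. Qed.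

Lemma ler_cmodD z w : cmod (z + w) <= cmod z + cmod w.
Proof. by rewrite -lecR rmorphD /= -!normc_cmod ler_normD. Qed.

Lemma lerB_cmod z w : cmod z - cmod w <= cmod (z + w).
Proof. by rewrite lerBlDr -(cmodN w) (le_trans _ (ler_cmodD _ _))// addrK. Qed.

Lemma ler_cmod_dist w z v : cmod (z - v) <= cmod (z - w) + cmod (w - v).
Proof. by rewrite (le_trans _ (ler_cmodD _ _))// addrA subrK. Qed.

Lemma ler_Re_cmod z : `|complex.Re z| <= cmod z.
Proof. by rewrite -lecR -normc_cmod normc_ge_Re. Qed.

Lemma ler_Im_cmod z : `|complex.Im z| <= cmod z.
Proof.
rewrite cmodE -(sqrtr_sqr (complex.Im z)) ler_sqrt ?addr_ge0 ?sqr_ge0//.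
by rewrite lerDr sqr_ge0.
Qed.

Lemma ler_cmod_ReIm z : cmod z <= `|complex.Re z| + `|complex.Im z|.
Proof.
rewrite {1}[z]complexE (le_trans (ler_cmodD _ _))// cmodM !cmodR.
suff -> : cmod ('i : C) = 1 by rewrite mul1r.
by rewrite cmodE /= expr0n expr1n add0r sqrtr1.
Qed.

Lemma ReD z w : complex.Re (z + w) = complex.Re z + complex.Re w.
Proof. by move: z w => [a b] [c d]. Qed.
Lemma ImD z w : complex.Im (z + w) = complex.Im z + complex.Im w.
Proof. by move: z w => [a b] [c d]. Qed.
Lemma ReN z : complex.Re (- z) = - complex.Re z.
Proof. by move: z => [a b]. Qed.
Lemma ImN z : complex.Im (- z) = - complex.Im z.
Proof. by move: z => [a b]. Qed.
Lemma ReM z w : complex.Re (z * w) =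
  complex.Re z * complex.Re w - complex.Im z * complex.Im w.
Proof. by move: z w => [a b] [c d]. Qed.
Lemma ImM z w : complex.Im (z * w) =
  complex.Re z * complex.Im w + complex.Im z * complex.Re w.
Proof. by move: z w => [a b] [c d]. Qed.
Lemma ReV z : complex.Re z^-1 =
  complex.Re z * (complex.Re z ^+ 2 + complex.Im z ^+ 2)^-1.
Proof. by move: z => [a b]. Qed.
Lemma ImV z : complex.Im z^-1 =
  - (complex.Im z * (complex.Re z ^+ 2 + complex.Im z ^+ 2)^-1).
Proof. by move: z => [a b]. Qed.

End ComplexModulus.

Section ComplexMeasurable.
Context d (T : measurableType d) (R : realType).
Local Notation C := R[i].

Lemma measurable_inv_ge0 (f : T -> R) : (forall t, 0 <= f t) ->
  measurable_fun [set: T] f -> measurable_fun [set: T] (fun t => (f t)^-1).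
Proof.
move=> f0 mf; have -> : (fun t => (f t)^-1) = (fun x => powR x (-1)) \o f.
  by apply/funext => t /=; rewrite powR_inv1.
exact: measurableT_comp (measurable_powR _) mf.
Qed.

Definition cmeasurable (f : T -> C) : Prop :=
  measurable_fun [set: T] (fun t => complex.Re (f t)) /\
  measurable_fun [set: T] (fun t => complex.Im (f t)).

Lemma cmeasurable_cst c : cmeasurable (fun=> c).
Proof. by split; exact: measurable_cst. Qed.

Lemma cmeasurableR (f : T -> R) : measurable_fun [set: T] f ->
  cmeasurable (fun t => (f t)%:C).
Proof. by move=> mf; split => //; exact: measurable_cst. Qed.

Lemma cmeasurableD f g : cmeasurable f -> cmeasurable g ->
  cmeasurable (fun t => f t + g t).
Proof.
move=> [f1 f2] [g1 g2]; split.
  by under eq_fun do rewrite ReD; exact: measurable_funD.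
by under eq_fun do rewrite ImD; exact: measurable_funD.
Qed.

Lemma cmeasurableN f : cmeasurable f -> cmeasurable (fun t => - f t).
Proof.
move=> [f1 f2]; split.
  by under eq_fun do rewrite ReN; exact: measurable_funN.
by under eq_fun do rewrite ImN; exact: measurable_funN.
Qed.

Lemma cmeasurableM f g : cmeasurable f -> cmeasurable g ->
  cmeasurable (fun t => f t * g t).
Proof.
move=> [f1 f2] [g1 g2]; split.
  under eq_fun do rewrite ReM.
  by apply: measurable_funB; apply: measurable_funM.
under eq_fun do rewrite ImM.
by apply: measurable_funD; apply: measurable_funM.
Qed.

Lemma cmeasurableV f : cmeasurable f -> cmeasurable (fun t => (f t)^-1).
Proof.
move=> [f1 f2].
have h : measurable_fun [set: T]
    (fun t => (complex.Re (f t) ^+ 2 + complex.Im (f t) ^+ 2)^-1).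
  apply: measurable_inv_ge0 => [t|]; first by rewrite addr_ge0 ?sqr_ge0.
  by apply: measurable_funD; apply: measurable_funX.
split.
  by under eq_fun do rewrite ReV; exact: measurable_funM.
by under eq_fun do rewrite ImV; apply: measurable_funN; exact: measurable_funM.
Qed.

End ComplexMeasurable.

Section ComplexIntegral.
Variable R : realType.
Local Notation C := R[i].
Local Notation RB := (measurableTypeR R).
Variable mu : {finite_measure set RB -> \bar R}.

Lemma bounded_integrable (f : RB -> R) (M : R) :
  measurable_fun [set: RB] f -> (forall t, `|f t| <= M) ->
  mu.-integrable [set: RB] (EFin \o f).
Proof.
move=> mf fM; apply: measurable_bounded_integrable => //.
  exact: fin_num_fun_lty.
by exists M; split; [exact: num_real|move=> x Mx t _;
  exact: le_trans (fM t) (ltW Mx)].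
Qed.

Definition cbounded (f : RB -> C) : Prop :=
  cmeasurable f /\ exists M, forall t, cmod (f t) <= M.

Lemma cbounded_integrable f : cbounded f ->
  mu.-integrable [set: RB] (EFin \o (fun t => complex.Re (f t))) /\
  mu.-integrable [set: RB] (EFin \o (fun t => complex.Im (f t))).
Proof.
move=> [[mr mi] [M fM]]; split; apply: (@bounded_integrable _ M) => // t.
  exact: le_trans (ler_Re_cmod _) (fM t).
exact: le_trans (ler_Im_cmod _) (fM t).
Qed.

Lemma eq_cintegral (f g : R -> C) : f =1 g -> cintegral mu f = cintegral mu g.
Proof. by move=> /funext ->. Qed.

Lemma cintegralD f g : cbounded f -> cbounded g ->
  cintegral mu (fun t => f t + g t) = cintegral mu f + cintegral mu g.
Proof.
move=> /cbounded_integrable[f1 f2] /cbounded_integrable[g1 g2].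
rewrite /cintegral; apply/eqP; rewrite eq_complex /=; apply/andP; split.
  by under eq_Rintegral do rewrite ReD; rewrite RintegralD.
by under eq_Rintegral do rewrite ImD; rewrite RintegralD.
Qed.

Lemma cbounded_cst c : cbounded (fun=> c).
Proof. by split; [exact: cmeasurable_cst|exists (cmod c)]. Qed.

Lemma cboundedM f g : cbounded f -> cbounded g -> cbounded (fun t => f t * g t).
Proof.
move=> [mf [M fM]] [mg [N gN]]; split; first exact: cmeasurableM.
by exists (M * N) => t; rewrite cmodM ler_pM ?cmod_ge0.
Qed.

Lemma cboundedD f g : cbounded f -> cbounded g -> cbounded (fun t => f t + g t).
Proof.
move=> [mf [M fM]] [mg [N gN]]; split; first exact: cmeasurableD.
by exists (M + N) => t; rewrite (le_trans (ler_cmodD _ _))// lerD.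
Qed.

Lemma cboundedN f : cbounded f -> cbounded (fun t => - f t).
Proof.
move=> [mf [M fM]]; split; first exact: cmeasurableN.
by exists M => t; rewrite cmodN.
Qed.

Lemma cintegralZ c f : cbounded f ->
  cintegral mu (fun t => c * f t) = c * cintegral mu f.
Proof.
move=> /cbounded_integrable[f1 f2].
rewrite /cintegral; apply/eqP; rewrite eq_complex ReM ImM /=; apply/andP; split.
  under eq_Rintegral do rewrite ReM.
  rewrite RintegralB//= ?RintegralZl//.
  - exact: (integrableZl measurableT (complex.Re c) f1).
  - exact: (integrableZl measurableT (complex.Im c) f2).
under eq_Rintegral do rewrite ImM.
rewrite RintegralD//= ?RintegralZl//.
- exact: (integrableZl measurableT (complex.Re c) f2).
- exact: (integrableZl measurableT (complex.Im c) f1).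
Qed.

Lemma cintegralB f g : cbounded f -> cbounded g ->
  cintegral mu (fun t => f t - g t) = cintegral mu f - cintegral mu g.
Proof.
move=> bf bg; have bg' := cboundedN bg.
rewrite cintegralD//; congr (_ + _).
under eq_cintegral do rewrite -mulN1r.
by rewrite cintegralZ// mulN1r.
Qed.

(** The factor 2 comes from bounding the real and the imaginary part separately. *)
Lemma le_cmod_cintegral f (h : RB -> R) : cbounded f ->
  mu.-integrable [set: RB] (EFin \o h) -> (forall t, cmod (f t) <= h t) ->
  cmod (cintegral mu f) <= 2 * \int[mu]_t h t.
Proof.
move=> bf ih fh; have [i1 i2] := cbounded_integrable bf.
rewrite (le_trans (ler_cmod_ReIm _))//= mulr_natl mulr2n lerD//.
  rewrite (le_trans (le_normr_Rintegral _ _))// le_Rintegral//.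
    exact: integrable_norm i1.
  by move=> t _; exact: le_trans (ler_Re_cmod _) (fh t).
rewrite (le_trans (le_normr_Rintegral _ _))// le_Rintegral//.
  exact: integrable_norm i2.
by move=> t _; exact: le_trans (ler_Im_cmod _) (fh t).
Qed.

End ComplexIntegral.

Section BoundedConvergence.
Variable R : realType.
Local Notation C := R[i].
Local Notation RB := (measurableTypeR R).
Variable mu : {finite_measure set RB -> \bar R}.

Lemma cvg_Rintegral_bounded (f : nat -> RB -> R) (g : RB -> R) (M : R) :
  (forall n, measurable_fun [set: RB] (f n)) -> measurable_fun [set: RB] g ->
  (forall n t, `|f n t| <= M) -> (forall t, f ^~ t @ \oo --> g t) ->
  (fun n => \int[mu]_t f n t) @ \oo --> \int[mu]_t g t.
Proof.
move=> mf mg fM fg; rewrite /Rintegral.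
have [| | |||ig _ h] := @dominated_convergence _ _ _ mu [set: RB] measurableT
    (fun n => EFin \o f n) (EFin \o g) (EFin \o cst M).
- by move=> n; exact/measurable_EFinP.
- exact/measurable_EFinP.
- by apply: aeW => t _; apply: cvg_EFin; [exact: nearW|exact: fg].
- exact: finite_measure_integrable_cst.
- by apply: aeW => t n _; rewrite lee_fin.
apply: fine_cvg; rewrite fineK//; exact: integrable_fin_num.
Qed.

Lemma cvg_cintegral_bounded (f : nat -> RB -> C) (g : RB -> C) (M : R) :
  (forall n, cmeasurable (f n)) -> cmeasurable g ->
  (forall n t, cmod (f n t) <= M) ->
  (forall t, (fun n => cmod (f n t - g t)) @ \oo --> 0) ->
  (fun n => cmod (cintegral mu (f n) - cintegral mu g)) @ \oo --> 0.
Proof.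
move=> mf mg fM fg.
have Rec : (fun n => complex.Re (cintegral mu (f n))) @ \oo -->
    complex.Re (cintegral mu g).
  apply: (@cvg_Rintegral_bounded _ _ M) => [n||n t|t].
  - exact: (mf n).1.
  - exact: mg.1.
  - exact: le_trans (ler_Re_cmod _) (fM n t).
  apply/cvgrPdistC_le => e e0; near=> n.
  rewrite -ReN -ReD (le_trans (ler_Re_cmod _))//.
  rewrite -[leLHS]ger0_norm ?cmod_ge0// -[cmod _]subr0; near: n.
  by have /cvgr_distC_le := fg t; exact.
have Imc : (fun n => complex.Im (cintegral mu (f n))) @ \oo -->
    complex.Im (cintegral mu g).
  apply: (@cvg_Rintegral_bounded _ _ M) => [n||n t|t].
  - exact: (mf n).2.
  - exact: mg.2.
  - exact: le_trans (ler_Im_cmod _) (fM n t).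
  apply/cvgrPdistC_le => e e0; near=> n.
  rewrite -ImN -ImD (le_trans (ler_Im_cmod _))//.
  rewrite -[leLHS]ger0_norm ?cmod_ge0// -[cmod _]subr0; near: n.
  by have /cvgr_distC_le := fg t; exact.
apply/cvgrPdistC_le => e e0.
have e2 : 0 < e / 2 by rewrite divr_gt0.
near=> n; rewrite subr0 ger0_norm ?cmod_ge0// (le_trans (ler_cmod_ReIm _))//.
rewrite ReD ReN ImD ImN [leRHS]splitr lerD//; near: n.
  by have /cvgr_distC_le := Rec; exact.
by have /cvgr_distC_le := Imc; exact.
Unshelve. all: by end_near. Qed.

End BoundedConvergence.

(** * The fixed-point equation *)

Section Cone.
Variable R : realType.
Local Notation C := R[i].

(** This is the form in which the sector condition enters the estimates: a lower bound on |1 - z s|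
    with the growth 1 + |z| s of the denominator in [kappa]. The negative half-line has c = 1
    ([cone_neg]); wider sectors get a smaller c ([sector_cone]). *)
Definition cone (c : R) (z : C) : Prop :=
  forall s, 0 <= s -> c * (1 + cmod z * s) <= cmod (1 - z * s%:C).

Lemma mtilde_dist (lambda : R) (m m' : C) :
  mtilde lambda m - mtilde lambda m' = lambda%:C * (m - m').
Proof. by rewrite /mtilde; ring. Qed.

Lemma mtilde1 (lambda : R) : mtilde lambda 1 = 1 :> C.
Proof. by rewrite /mtilde mulr1 -rmorphD /= addrC subrK. Qed.

Lemma cmod_mtilde1 (lambda rho : R) (m : C) : 0 <= lambda <= 1 ->
  cmod (m - 1) <= rho -> cmod (mtilde lambda m - 1) <= rho.
Proof.
move=> /andP[l0 l1] mr.
have := mtilde_dist lambda m 1; rewrite mtilde1 => ->.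
rewrite cmodM cmodR ger0_norm//.
by rewrite (le_trans _ mr)// ler_piMl ?cmod_ge0.
Qed.

Lemma cmod_le2 (m : C) : cmod (m - 1) <= 1 -> cmod m <= 2.
Proof.
move=> m1; rewrite -[m](subrK 1) (le_trans (ler_cmodD _ _))// cmod1.
lra.
Qed.

(** The product of two numbers within rho of 1 is within 2 rho + rho^2 of 1, rounded up to 3 rho. *)
Lemma cmod_mul_mtilde1 (lambda rho : R) (m : C) : 0 <= lambda <= 1 ->
  rho <= 1 -> cmod (m - 1) <= rho ->
  cmod (m * mtilde lambda m - 1) <= 3 * rho.
Proof.
move=> hl r1 mr.
have -> : m * mtilde lambda m - 1
  = (m - 1) + (mtilde lambda m - 1) + (m - 1) * (mtilde lambda m - 1) by ring.
have mtr := cmod_mtilde1 hl mr.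
have h : cmod (m - 1) * cmod (mtilde lambda m - 1) <= rho * 1.
  by rewrite ler_pM ?cmod_ge0// (le_trans mtr).
rewrite (le_trans (ler_cmodD _ _))// (le_trans (lerD (ler_cmodD _ _) (lexx _)))//.
rewrite cmodM; lra.
Qed.

(** The error z s (q - 1) costs at most c / 2 times |z| s, so half of the cone constant survives. *)
Lemma cone_perturb (c : R) (z q : C) (s : R) : cone c z -> 0 <= s ->
  cmod (q - 1) <= c / 2 ->
  c / 2 * (1 + cmod z * s) <= cmod (1 - z * q * s%:C).
Proof.
move=> zc s0 qc; have := zc _ s0.
have -> : 1 - z * q * s%:C = (1 - z * s%:C) + - (z * s%:C * (q - 1)) by ring.
have := lerB_cmod (1 - z * s%:C) (- (z * s%:C * (q - 1))).
rewrite cmodN !cmodM cmodR (ger0_norm s0).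
have : cmod z * s * cmod (q - 1) <= cmod z * s * (c / 2).
  by rewrite ler_wpM2l// mulr_ge0 ?cmod_ge0.
have : 0 <= c / 2 by rewrite (le_trans _ qc) ?cmod_ge0.
move: (cmod z * s) => x; move: (cmod _) (cmod _) (cmod _) => a b d.
nra.
Qed.

End Cone.

(** * Estimates for the kernel (1 + x) / (1 - w x) *)

Section LevyKernel.
Variable R : realType.
Local Notation C := R[i].
Local Notation RB := (measurableTypeR R).
Variable G : {finite_measure set RB -> \bar R}.

(* [s] stands for [t ^+ 2] or for a simple function approximating it. *)
Definition levyD (s : RB -> R) (w : C) : C :=
  cintegral G (fun t => (1 + s t)%:C / (1 - w * (s t)%:C)).

(** Up to a constant depending on the cone, this bounds |w D(w)| at |w| = r. For 0 < r <= 1 the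
    integrand is at most 1, and it tends to 0 with r, hence so does the integral. *)
Definition kappa (r : R) : R := \int[G]_t (r * (1 + t ^+ 2) / (1 + r * t ^+ 2)).

(** The bound by t^2 makes the estimates through [kappa] uniform in [s], because the kernel of
    [kappa] increases with t^2. *)
Definition approx_sqr (s : RB -> R) : Prop :=
  [/\ measurable_fun [set: RB] s, forall t, 0 <= s t & forall t, s t <= t ^+ 2].

Lemma approx_sqr_sqr : approx_sqr (fun t : RB => t ^+ 2).
Proof.
split=> [|t|t//]; last exact: sqr_ge0.
exact: measurable_funX.
Qed.

Lemma le_levy_kernel (r x y : R) : 0 < r <= 1 -> 0 <= x <= y ->
  r * (1 + x) / (1 + r * x) <= r * (1 + y) / (1 + r * y).
Proof.
move=> /andP[r0 r1] /andP[x0 xy].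
have y0 : 0 <= y by exact: le_trans xy.
have dx : 0 < 1 + r * x by rewrite ltr_wpDr// mulr_ge0// ltW.
have dy : 0 < 1 + r * y by rewrite ltr_wpDr// mulr_ge0// ltW.
rewrite ler_pdivrMr// mulrAC ler_pdivlMr// -subr_ge0.
have -> : r * (1 + y) * (1 + r * x) - r * (1 + x) * (1 + r * y)
  = r * (1 - r) * (y - x) by ring.
by rewrite !mulr_ge0 ?subr_ge0// ltW.
Qed.

Lemma levy_kernel_le1 (r x : R) : 0 < r <= 1 -> 0 <= x ->
  0 <= r * (1 + x) / (1 + r * x) <= 1.
Proof.
move=> /andP[r0 r1] x0.
have dx : 0 < 1 + r * x by rewrite ltr_wpDr// mulr_ge0// ltW.
rewrite divr_ge0 ?(ltW dx) ?mulr_ge0 ?addr_ge0// ?(ltW r0)//=.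
by rewrite ler_pdivrMr// mul1r mulrDr mulr1 lerD2r.
Qed.

Lemma kappa_integrable (r : R) : 0 < r <= 1 ->
  G.-integrable [set: RB] (EFin \o (fun t : RB => r * (1 + t ^+ 2) / (1 + r * t
    ^+ 2))).
Proof.
move=> r1; have r0 : 0 <= r by case/andP: r1 => /ltW.
apply: (@bounded_integrable _ _ _ 1) => [|t].
  apply: measurable_funM; first by apply: measurable_funM => //;
    apply: measurable_funD => //; exact: measurable_funX.
  apply: measurable_inv_ge0 => [t|]; first by rewrite addr_ge0// mulr_ge0// sqr_ge0.
  apply: measurable_funD => //; apply: measurable_funM => //; exact: measurable_funX.
by have /andP[h0 h1] := levy_kernel_le1 r1 (sqr_ge0 t); rewrite ger0_norm.
Qed.

Lemma levy_kernel_bound (w : C) (c r x : R) : 0 < c -> 0 < r -> 0 <= x ->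
  c * (1 + r * x) <= cmod (1 - w * x%:C) ->
  cmod ((1 + x)%:C / (1 - w * x%:C)) <= (1 + r^-1) / c.
Proof.
move=> c0 r0 x0 cd; rewrite cmodM cmodV cmodR.
have s1 : 0 <= 1 + x by rewrite addr_ge0.
have d0 : 0 < 1 + r * x by rewrite ltr_wpDr// mulr_ge0// ltW.
have d1 : 0 < cmod (1 - w * x%:C) by apply: lt_le_trans cd; rewrite mulr_gt0.
rewrite ger0_norm// ler_pdivrMr// mulrAC ler_pdivlMr//.
apply: (@le_trans _ _ ((1 + r^-1) * (c * (1 + r * x)))); last first.
  by rewrite ler_wpM2l// addr_ge0// invr_ge0 ltW.
rewrite mulrCA mulrC ler_pM2l//.
have -> : (1 + r^-1) * (1 + r * x) = 1 + x + r^-1 + r * x.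
  by field; rewrite gt_eqF.
by rewrite -addrA lerDl addr_ge0// ?invr_ge0 ?mulr_ge0// ltW.
Qed.

(** As a function of x the kernel is a Moebius map of determinant 1 + w, hence the factor |1 + w|.
    This serves for the pointwise convergence of the integrands when simple functions tend to
    t^2. *)
Lemma levy_kernel_lipschitz (w : C) (c x y : R) : 0 < c ->
  c <= cmod (1 - w * x%:C) -> c <= cmod (1 - w * y%:C) ->
  cmod ((1 + x)%:C / (1 - w * x%:C) - (1 + y)%:C / (1 - w * y%:C))
  <= cmod (1 + w) / c ^+ 2 * `|x - y|.
Proof.
move=> c0 cx cy.
have nx : 1 - w * x%:C != 0 by rewrite -cmod_gt0 (lt_le_trans c0).
have ny : 1 - w * y%:C != 0 by rewrite -cmod_gt0 (lt_le_trans c0).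
rewrite !rmorphD /=.
have -> : (1 + x%:C) / (1 - w * x%:C) - (1 + y%:C) / (1 - w * y%:C)
  = (1 + w) * (x - y)%:C / ((1 - w * x%:C) * (1 - w * y%:C)).
  by rewrite rmorphB /=; field; rewrite nx ny.
rewrite !cmodM cmodV cmodM cmodR mulrAC ler_wpM2r//.
rewrite ler_wpM2l ?cmod_ge0// lef_pV2 ?posrE ?exprn_gt0 ?mulr_gt0 ?cmod_gt0//.
by rewrite expr2 ler_pM// ltW.
Qed.

Lemma cmeasurable_levy_kernel (s : RB -> R) (w : C) :
  measurable_fun [set: RB] s ->
  cmeasurable (fun t : RB => (1 + s t)%:C / (1 - w * (s t)%:C)).
Proof.
move=> ms.
apply: cmeasurableM; first by apply: cmeasurableR; exact: measurable_funD.
apply: cmeasurableV; apply: cmeasurableD; first exact: cmeasurable_cst.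
apply: cmeasurableN; apply: cmeasurableM; first exact: cmeasurable_cst.
exact: cmeasurableR.
Qed.

Lemma cbounded_levyD (s : RB -> R) (w : C) (c r : R) :
  measurable_fun [set: RB] s -> (forall t, 0 <= s t) -> 0 < c -> 0 < r ->
  (forall x, 0 <= x -> c * (1 + r * x) <= cmod (1 - w * x%:C)) ->
  cbounded (fun t : RB => (1 + s t)%:C / (1 - w * (s t)%:C)).
Proof.
move=> ms s0 c0 r0 wc; split; first exact: cmeasurable_levy_kernel.
by exists ((1 + r^-1) / c) => t; apply: levy_kernel_bound => //; exact: wc.
Qed.

End LevyKernel.

(** * The fixed-point map contracts a small disc around 1 *)

Lemma cmod_1B (R : realType) (e : R[i]) : cmod e <= 1 / 12 ->
  11 / 12 <= cmod (1 - e).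
Proof. by move=> h; have := lerB_cmod 1 (- e); rewrite cmod1 cmodN; lra. Qed.

(** Both denominators have modulus at least 11/12, and 2 (11/12)^2 >= 1. *)
Lemma inv1B_dist (R : realType) (e e' : R[i]) :
  cmod e <= 1 / 12 -> cmod e' <= 1 / 12 ->
  cmod ((1 - e)^-1 - (1 - e')^-1) <= 2 * cmod (e - e').
Proof.
move=> /cmod_1B h /cmod_1B h'.
have en : 1 - e != 0 by rewrite -cmod_gt0; lra.
have en' : 1 - e' != 0 by rewrite -cmod_gt0; lra.
have -> : (1 - e)^-1 - (1 - e')^-1 = (e - e') / ((1 - e) * (1 - e')).
  by field; rewrite en en'.
rewrite cmodM cmodV cmodM ler_pdivrMr ?mulr_gt0 ?cmod_gt0// mulrAC.
rewrite ler_peMl ?cmod_ge0//; nra.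
Qed.

Section Contraction.
Variable R : realType.
Local Notation C := R[i].
Local Notation RB := (measurableTypeR R).
Variable G : {finite_measure set RB -> \bar R}.
Variable lambda : R.
Hypothesis hl : 0 <= lambda <= 1.

Definition fixE (D : C -> C) (z m : C) : C :=
  z * mtilde lambda m * D (z * m * mtilde lambda m).

Variables (c : R) (z : C) (s : RB -> R).
Hypothesis c01 : 0 < c <= 1.
Hypothesis zc : cone c z.
Hypothesis z01 : 0 < cmod z <= 1.
Hypothesis sP : approx_sqr s.

(** The radius c / 6 has its origin here: three times it is the c / 2 tolerated by
    [cone_perturb]. *)
Lemma fixE_den (m : C) (x : R) : cmod (m - 1) <= c / 6 -> 0 <= x ->
  c / 2 * (1 + cmod z * x) <= cmod (1 - z * m * mtilde lambda m * x%:C).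
Proof.
move=> mc x0; rewrite -[z * m * _]mulrA; apply: cone_perturb => //.
have -> : c / 2 = 3 * (c / 6) by field.
by apply: cmod_mul_mtilde1 => //; case/andP: c01 => ? ?; lra.
Qed.

Lemma fixE_kernel_cbounded (m : C) : cmod (m - 1) <= c / 6 ->
  cbounded (fun t : RB => (1 + s t)%:C / (1 - z * m * mtilde lambda m * (s t)%:C)).
Proof.
move=> mc; have [ms s0 _] := sP; have [c0 c1] := andP c01; have [z0 _] := andP z01.
apply: (@cbounded_levyD _ _ _ (c / 2) (cmod z)) => //; first by rewrite divr_gt0.
by move=> x x0; exact: fixE_den.
Qed.

Lemma cmod_fixE (m : C) : cmod (m - 1) <= c / 6 ->
  cmod (fixE (levyD G s) z m) <= 32 / c ^+ 2 * kappa G (cmod z).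
Proof.
move=> mc; have [ms s0 s2] := sP; have [c0 c1] := andP c01; have [z0 z1] := andP z01.
have bk := fixE_kernel_cbounded mc.
rewrite /fixE /levyD -cintegralZ//.
have ik := kappa_integrable G z01.
have := @le_cmod_cintegral _ G
  (fun t => z * mtilde lambda m * ((1 + s t)%:C / (1 - z * m * mtilde lambda m *
    (s t)%:C)))
  (fun t => 16 / c ^+ 2 * (cmod z * (1 + t ^+ 2) / (1 + cmod z * t ^+ 2))).
rewrite RintegralZl// mulrA => h.
(* From |mtilde| <= 2 and the denominator bound the kernel gets the constant 4 / c. It is relaxed to
   16 / c^2, the constant of the Lipschitz estimate below, so that one smallness condition covers
   both; [le_cmod_cintegral] doubles it to 32 / c^2. *)
rewrite (_ : 32 / _ = 2 * (16 / c ^+ 2)); last by field; rewrite gt_eqF.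
apply: h => [||t].
- by apply: cboundedM => //; exact: cbounded_cst.
- exact: (integrableZl measurableT (16 / c ^+ 2) ik).
have st := s0 t; have den := fixE_den mc st.
have d0 : 0 < 1 + cmod z * s t by rewrite ltr_wpDr// mulr_ge0// ltW.
have s1 : 0 <= 1 + s t by rewrite addr_ge0.
rewrite !cmodM cmodV cmodR ger0_norm//.
have mt2 : cmod (mtilde lambda m) <= 2.
  by apply: cmod_le2; apply: cmod_mtilde1 => //; lra.
apply: (@le_trans _ _ (16 / c ^+ 2 * (cmod z * (1 + s t) / (1 + cmod z * s t))));
  last first.
  by rewrite ler_wpM2l ?divr_ge0 ?sqr_ge0// le_levy_kernel// st s2.
have c2 : 0 < c / 2 * (1 + cmod z * s t) by rewrite mulr_gt0// divr_gt0.
apply: (@le_trans _ _ (cmod z * (1 + s t) * 2 / (c / 2 * (1 + cmod z * s t)))).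
  rewrite mulrA [cmod z * _ * (1 + s t)]mulrAC ler_pM//.
  - by rewrite !mulr_ge0 ?cmod_ge0.
  - by rewrite invr_ge0 cmod_ge0.
  - by rewrite ler_wpM2l// mulr_ge0// ltW.
  - by rewrite lef_pV2// posrE// (lt_le_trans c2).
rewrite (_ : cmod z * _ * _ / _ =
  4 / c * (cmod z * (1 + s t) / (1 + cmod z * s t))); last first.
  by field; rewrite !gt_eqF.
rewrite ler_wpM2r ?divr_ge0 ?mulr_ge0 ?cmod_ge0// ?(ltW d0)//.
rewrite (_ : 4 / c = 4 * c / c ^+ 2); last by field; rewrite gt_eqF.
by rewrite ler_wpM2r ?invr_ge0 ?sqr_ge0//; lra.
Qed.

Lemma fixE_lipschitz (m m' : C) : cmod (m - 1) <= c / 6 ->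
  cmod (m' - 1) <= c / 6 ->
  cmod (fixE (levyD G s) z m - fixE (levyD G s) z m')
  <= 32 / c ^+ 2 * kappa G (cmod z) * cmod (m - m').
Proof.
move=> mc mc'; have [ms s0 s2] := sP; have [c0 c1] := andP c01;
  have [z0 z1] := andP z01.
have bk := fixE_kernel_cbounded mc.
have bk' := fixE_kernel_cbounded mc'.
have ik := kappa_integrable G z01.
set k := fun m t => z * mtilde lambda m * ((1 + s t)%:C / (1 - z * m * mtilde
  lambda m * (s t)%:C)).
have bz : cbounded (k m) by apply: cboundedM => //; exact: cbounded_cst.
have bz' : cbounded (k m') by apply: cboundedM => //; exact: cbounded_cst.
rewrite /fixE /levyD -!cintegralZ// -/(k m) -/(k m') -cintegralB//.
have := @le_cmod_cintegral _ G (fun t => k m t - k m' t)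
  (fun t => 16 / c ^+ 2 * cmod (m - m') * (cmod z * (1 + t ^+ 2) / (1 + cmod z *
    t ^+ 2))).
rewrite RintegralZl// mulrA => h.
rewrite (_ : 32 / _ * _ * _ = 2 * (16 / c ^+ 2 * cmod (m - m')) * kappa G (cmod
  z)); last first.
  by field; rewrite gt_eqF.
apply: h => [||t].
- by apply: cboundedD => //; exact: cboundedN.
- exact: (integrableZl measurableT (16 / c ^+ 2 * cmod (m - m')) ik).
have st := s0 t; have den := fixE_den mc st; have den' := fixE_den mc' st.
have d0 : 0 < 1 + cmod z * s t by rewrite ltr_wpDr// mulr_ge0// ltW.
have s1 : 0 <= 1 + s t by rewrite addr_ge0.
have c2 : 0 < c / 2 * (1 + cmod z * s t) by rewrite mulr_gt0// divr_gt0.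
have ball1 q : cmod (q - 1) <= c / 6 -> cmod (mtilde lambda q) <= 2.
  by move=> qc; apply: cmod_le2; apply: cmod_mtilde1 => //; lra.
apply: (@le_trans _ _ (16 / c ^+ 2 * cmod (m - m') * (cmod z * (1 + s t) / (1 +
  cmod z * s t)))); last first.
  by rewrite ler_wpM2l ?mulr_ge0 ?invr_ge0 ?sqr_ge0 ?cmod_ge0// le_levy_kernel//
    st s2.
rewrite /k; set D := 1 - z * m * _ * _; set D' := 1 - z * m' * _ * _.
have dp : 0 < cmod D by apply: lt_le_trans den.
have dp' : 0 < cmod D' by apply: lt_le_trans den'.
(* Over the common denominator the numerator has the factor m - m'. Its last factor grows like 1 +
   |z| s, which cancels one of the two denominators and leaves the integrand of [kappa], with
   constant 4 / (c / 2)^2 = 16 / c^2. *)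
have -> : z * mtilde lambda m * ((1 + s t)%:C / D) - z * mtilde lambda m' * ((1 +
  s t)%:C / D')
  = z * (1 + s t)%:C * (m - m') *
    (lambda%:C + z * (s t)%:C * (mtilde lambda m * mtilde lambda m')) / (D * D').
  have Dn : D != 0 by rewrite -cmod_gt0.
  have Dn' : D' != 0 by rewrite -cmod_gt0.
  apply: (@mulIf _ (D * D')); first by rewrite mulf_neq0.
  rewrite divfK ?mulf_neq0//.
  transitivity (z * (1 + s t)%:C * (mtilde lambda m * D' - mtilde lambda m' * D)).
    by field; rewrite Dn Dn'.
  by rewrite /D /D' /mtilde; ring.
rewrite !cmodM cmodV cmodM cmodR (ger0_norm s1).
have num : cmod (lambda%:C + z * (s t)%:C * (mtilde lambda m * mtilde lambda m'))
    <= 4 * (1 + cmod z * s t).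
  rewrite (le_trans (ler_cmodD _ _))// !cmodM !cmodR (ger0_norm st).
  have : cmod (mtilde lambda m) * cmod (mtilde lambda m') <= 2 * 2.
    by rewrite ler_pM ?cmod_ge0// ball1.
  have l1 : `|lambda| <= 1 by case/andP: hl => l0 ?; rewrite ger0_norm.
  have : 0 <= cmod z * s t by rewrite mulr_ge0// cmod_ge0.
  move: (cmod z * s t) (_ * cmod (mtilde lambda m')) => x y x0 y4.
  have : x * y <= x * (2 * 2) by rewrite ler_wpM2l.
  lra.
apply: (@le_trans _ _ (cmod z * (1 + s t) * cmod (m - m') * (4 * (1 + cmod z * s
  t)) /
   ((c / 2 * (1 + cmod z * s t)) * (c / 2 * (1 + cmod z * s t))))).
  rewrite ler_pM//.
  - by rewrite !mulr_ge0 ?cmod_ge0.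
  - by rewrite invr_ge0 mulr_ge0 ?cmod_ge0.
  - by rewrite ler_wpM2l// !mulr_ge0 ?cmod_ge0.
  - by rewrite lef_pV2 ?posrE ?mulr_gt0// ler_pM// ltW.
rewrite le_eqVlt; apply/orP; left; apply/eqP; field.
by rewrite !gt_eqF.
Qed.

Hypothesis zk : 32 / c ^+ 2 * kappa G (cmod z) <= c / 12.

Lemma fixstep_ball (m : C) : cmod (m - 1) <= c / 6 ->
  cmod (fixstep lambda (levyD G s) z m - 1) <= c / 6.
Proof.
move=> mc; have [c0 c1] := andP c01.
have Ek := le_trans (cmod_fixE mc) zk.
rewrite /fixstep -/(fixE _ z m); set e := fixE _ _ _ in Ek *.
have e1 : 11 / 12 <= cmod (1 - e).
  have := lerB_cmod 1 (- e); rewrite cmod1 cmodN; lra.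
have en : 1 - e != 0 by rewrite -cmod_gt0; lra.
have -> : (1 - e)^-1 - 1 = e / (1 - e) by field.
rewrite cmodM cmodV ler_pdivrMr ?cmod_gt0//.
apply: le_trans Ek _; nra.
Qed.

Lemma fixstep_contract (m m' : C) : cmod (m - 1) <= c / 6 ->
  cmod (m' - 1) <= c / 6 ->
  cmod (fixstep lambda (levyD G s) z m - fixstep lambda (levyD G s) z m')
  <= 2^-1 * cmod (m - m').
Proof.
move=> mc mc'; have [c0 c1] := andP c01.
have cD : c / 12 <= 1 / 12 by rewrite ler_pM2r ?invr_gt0.
have Ek := le_trans (le_trans (cmod_fixE mc) zk) cD.
have Ek' := le_trans (le_trans (cmod_fixE mc') zk) cD.
apply: (le_trans (inv1B_dist Ek Ek')).
rewrite -ler_pdivlMl// mulrA (le_trans (fixE_lipschitz mc mc'))//.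
rewrite ler_wpM2r ?cmod_ge0// (le_trans zk)// (le_trans cD)//.
by rewrite div1r -invfM -natrM lef_pV2 ?posrE ?ltr0n// ler_nat.
Qed.

Lemma fixstep_unique (m m' : C) : cmod (m - 1) <= c / 6 ->
  cmod (m' - 1) <= c / 6 ->
  m = fixstep lambda (levyD G s) z m -> m' = fixstep lambda (levyD G s) z m' ->
  m = m'.
Proof.
move=> mc mc' me me'; apply/eqP; rewrite -subr_eq0 -cmod_eq0.
have := fixstep_contract mc mc'; rewrite -me -me' => h.
have := cmod_ge0 (m - m'); lra.
Qed.

Lemma iter_fixstep_ball k :
  cmod (iter k (fixstep lambda (levyD G s) z) 1 - 1) <= c / 6.
Proof.
elim: k => [|k IH] /=; last exact: fixstep_ball.
by rewrite subrr cmod0; case/andP: c01 => c0 _; rewrite divr_ge0// ltW.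
Qed.

(** The rate does not depend on [s], which lets the number of iterations and the simple function
    advance together. *)
Lemma iter_fixstep_cauchy k :
  cmod (iter k.+1 (fixstep lambda (levyD G s) z) 1
        - iter k (fixstep lambda (levyD G s) z) 1) <= 2^-1 ^+ k.
Proof.
elim: k => [|k IH].
  have [c0 c1] := andP c01.
  by rewrite expr0 (le_trans (iter_fixstep_ball 1))//; lra.
apply: (le_trans (fixstep_contract (iter_fixstep_ball k.+1) (iter_fixstep_ball k))).
by rewrite exprS ler_pM2l// invr_gt0.
Qed.

End Contraction.

(** * Smallness of kappa, and simple functions in place of t^2 *)

Section SimpleApproximation.
Variable R : realType.
Local Notation C := R[i].
Local Notation RB := (measurableTypeR R).
Variable G : {finite_measure set RB -> \bar R}.

(** Dominated convergence gives the limit along r = 1 / (n + 1); the integrand increases with r,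
    which covers all smaller r. *)
Lemma kappa_small (e : R) : 0 < e ->
  exists2 b, 0 < b <= 1 & forall r, 0 < r < b -> kappa G r <= e.
Proof.
move=> e0.
have n01 n : 0 < (n.+1%:R^-1 : R) <= 1.
  by rewrite invr_gt0 ltr0n /= invf_le1 ?ltr0n// ler1n.
have := @cvg_Rintegral_bounded _ G
  (fun n (t : RB) => n.+1%:R^-1 * (1 + t ^+ 2) / (1 + n.+1%:R^-1 * t ^+ 2))
    (fun=> 0) 1.
rewrite (@Rintegral_cst _ _ _ G)// mul0r => h.
have {}h := h _ _ _ _.
have : (fun n => kappa G (n.+1%:R^-1)) @ \oo --> (0 : R).
  apply: h => [n||n t|t].
  - by apply/measurable_EFinP; case/integrableP: (kappa_integrable G (n01 n)).
  - exact: measurable_cst.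
  - by have /andP[h0 h1] := levy_kernel_le1 (n01 n) (sqr_ge0 t); rewrite ger0_norm.
  have hc : (fun n => n.+1%:R^-1 * (1 + t ^+ 2)) @ \oo --> (0 : R).
    rewrite -[0 in X in _ --> X](mul0r (1 + t ^+ 2)).
    by apply: cvgMl; exact: cvg_harmonic.
  apply: (squeeze_cvgr _ (cvg_cst 0) hc).
  apply: nearW => n; have /andP[-> _] := levy_kernel_le1 (n01 n) (sqr_ge0 t).
  have /andP[p0 _] := n01 n.
  rewrite /= ler_pdivrMr; last by rewrite ltr_wpDr// mulr_ge0 ?sqr_ge0// ltW.
  have t0 := sqr_ge0 t; have p0' := ltW p0.
  apply: ler_peMr; first exact: mulr_ge0 p0' (addr_ge0 ler01 t0).
  by rewrite lerDl; exact: mulr_ge0.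
move/cvgrPdistC_le/(_ e e0) => [N _ /(_ N (leqnn N))] /=.
rewrite subr0 => hN; exists (N.+1%:R^-1) => // r /andP[r0 rN].
apply: le_trans (le_trans (ler_norm _) hN).
have r1 : 0 < r <= 1 by rewrite r0 (le_trans (ltW rN))//; case/andP: (n01 N).
apply: le_Rintegral => //; [exact: kappa_integrable|exact: kappa_integrable|].
move=> t _; set x := t ^+ 2; have x0 : 0 <= x by exact: sqr_ge0.
have /andP[p0 _] := n01 N.
have r0' := ltW r0; have p0' := ltW p0.
have dr : 0 < 1 + r * x by rewrite ltr_wpDr// mulr_ge0.
have dN : 0 < 1 + N.+1%:R^-1 * x by rewrite ltr_wpDr// mulr_ge0.
rewrite ler_pdivrMr// mulrAC.
rewrite ler_pdivlMr// -subr_ge0.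
rewrite (_ : _ - _ = (N.+1%:R^-1 - r) * (1 + x)); last by ring.
by apply: mulr_ge0; [rewrite subr_ge0 ltW|exact: addr_ge0].
Qed.

Lemma cintegral_sum (I : Type) (l : seq I) (F : I -> RB -> C) :
  (forall i, cbounded (F i)) ->
  cbounded (fun t => \sum_(i <- l) F i t) /\
  cintegral G (fun t => \sum_(i <- l) F i t) = \sum_(i <- l) cintegral G (F i).
Proof.
move=> bF; elim: l => [|i l [bl IH]].
  under [X in cbounded X]eq_fun do rewrite big_nil.
  split; first exact: cbounded_cst.
  under eq_cintegral do rewrite big_nil.
  by rewrite big_nil /cintegral /= (@Rintegral_cst _ _ _ G)// mul0r.
under [X in cbounded X]eq_fun do rewrite big_cons.
split; first exact: cboundedD.
under eq_cintegral do rewrite big_cons.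
by rewrite big_cons cintegralD// IH.
Qed.

Lemma cintegral_indic (A : set RB) : measurable A ->
  cintegral G (fun t => (\1_A t)%:C) = (fine (G A))%:C.
Proof.
move=> mA; rewrite /cintegral /= (@Rintegral_cst _ _ _ G)// mul0r; congr Complex.
by rewrite /Rintegral integral_indic// setIT.
Qed.

Lemma cbounded_indic (A : set RB) : measurable A ->
  cbounded (fun t : RB => (\1_A t)%:C : C).
Proof.
move=> mA; split; first by apply: cmeasurableR; exact: measurable_indic.
by exists 1 => t; rewrite cmodR indicE ger0_norm// lern1 leq_b1.
Qed.

(** On each level set {s = y} the kernel is constant, so D becomes a finite sum while G is left
    unchanged; the atom at y has the mass of that level set. *)
Lemma levyD_simple (s : RB -> R) : measurable_fun [set: RB] s ->
  (forall t, 0 <= s t) -> finite_set (range s) ->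
  exists l : seq (R * R), (forall x, x \in l -> 0 <= x.1 /\ 0 <= x.2) /\
    forall w, levyD G s w = atomicD l w.
Proof.
move=> ms s0 fs.
pose V : seq R := finmap.enum_fset (fset_set (range s)).
have VE y : (y \in V) = (y \in range s) by rewrite -(in_fset_set fs).
have Vu : uniq V by exact: finmap.fset_uniq.
pose A y := s @^-1` [set y].
have mA y : measurable (A y).
  by rewrite -[A y]setTI; apply: ms => //; exact: measurable_set1.
exists [seq (fine (G (A y)), y) | y <- V]; split.
  move=> _ /mapP[y yV ->] /=; split; first exact: fine_ge0.
  by move: yV; rewrite VE inE => -[t _ <-].
move=> w; rewrite /atomicD big_map /levyD.
pose F y t : C := (1 + y)%:C / (1 - w * y%:C) * (\1_(A y) t)%:C.
have -> : (fun t => (1 + s t)%:C / (1 - w * (s t)%:C)) = fun t => \sum_(y <- V) F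
  y t.
  apply/funext => t.
  have sV : s t \in V by rewrite VE inE; exists t.
  rewrite (bigD1_seq (s t))//= big1 ?addr0 => [|y yt].
    by rewrite /F indicE mem_set// mulr1.
  rewrite /F indicE memNset ?mulr0//.
  by move=> h; move: yt; rewrite -h eqxx.
have bF y : cbounded (F y).
  by apply: cboundedM; [exact: cbounded_cst|exact: cbounded_indic].
rewrite (cintegral_sum V bF).2; apply: eq_bigr => y _ /=.
rewrite /F cintegralZ ?cintegral_indic//; last exact: cbounded_indic.
by rewrite rmorphM /= mulrC mulrA.
Qed.

Lemma sqr_approximation : exists s : nat -> RB -> R,
  [/\ forall n, approx_sqr (s n), forall t, (s n t @[n --> \oo]) --> t ^+ 2
    & forall n, exists l : seq (R * R),
       (forall x, x \in l -> 0 <= x.1 /\ 0 <= x.2) /\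
       forall w, levyD G (s n) w = atomicD l w].
Proof.
have msq : measurable_fun [set: RB] (EFin \o (fun t : RB => t ^+ 2)).
  by apply/measurable_EFinP; exact: measurable_funX.
pose s := nnsfun_approx measurableT msq.
have scvg t : (fun n => s n t) @ \oo --> t ^+ 2.
  have h := @cvg_nnsfun_approx _ _ _ _ measurableT _ msq
    (fun t _ => sqr_ge0 t) t I.
  exact: (fine_cvg h).
have sle n t : s n t <= t ^+ 2.
  have nd : nondecreasing_seq (fun n => s n t).
    by move=> i j ij; have /lefP := nd_nnsfun_approx measurableT msq ij; exact.
  rewrite -(cvg_lim _ (scvg t))//.
  by apply: nondecreasing_cvgn_le => //; apply/cvg_ex; exists (t ^+ 2); exact: scvg.
have s0 n t : 0 <= s n t by [].
have ms n : measurable_fun [set: RB] (s n) by exact: measurable_funPT.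
exists (fun n => s n); split => // n.
by apply: levyD_simple => //; exact: fimfunP.
Qed.

End SimpleApproximation.

(** * Limits of the iterates are fixed points *)

Section FixpointLimit.
Variable R : realType.
Local Notation C := R[i].
Local Notation RB := (measurableTypeR R).
Variable G : {finite_measure set RB -> \bar R}.
Variable lambda : R.
Hypothesis hl : 0 <= lambda <= 1.
Variables (c : R) (z : C).
Hypothesis c01 : 0 < c <= 1.
Hypothesis zc : cone c z.
Hypothesis z01 : 0 < cmod z <= 1.
Hypothesis zk : 32 / c ^+ 2 * kappa G (cmod z) <= c / 12.
Variable s : nat -> RB -> R.
Hypothesis sP : forall n, approx_sqr (s n).
Hypothesis s_cvg : forall t, s n t @[n --> \oo] --> t ^+ 2.

Local Notation sqr := (fun t : RB => t ^+ 2).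
Local Notation S D := (fixstep lambda D z).

Lemma cvg_fixstep (m : C) : cmod (m - 1) <= c / 6 ->
  cmod (S (levyD G (s n)) m - S (levyD G sqr) m) @[n --> \oo] --> 0.
Proof.
move=> mc; have [c0 c1] := andP c01; have [z0 z1] := andP z01.
set w := z * m * mtilde lambda m.
have den := fixE_den hl c01 zc mc; rewrite -/w in den.
have ch : 0 < c / 2 by rewrite divr_gt0.
have chle x : 0 <= x -> c / 2 <= cmod (1 - w * x%:C).
  by move=> x0; apply: le_trans (den _ x0);
    rewrite ler_peMr ?lerDl ?mulr_ge0 ?cmod_ge0// ltW.
have [msq sq0 _] := approx_sqr_sqr R.
have Dcvg : cmod (levyD G (s n) w - levyD G sqr w) @[n --> \oo] --> 0.
  apply: (@cvg_cintegral_bounded _ _ _ _ ((1 + (cmod z)^-1) / (c / 2))).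
  - by move=> n; apply: cmeasurable_levy_kernel; case: (sP n).
  - exact: cmeasurable_levy_kernel.
  - by move=> n t; have [_ s0 _] := sP n; apply: levy_kernel_bound => //; exact: den.
  move=> t; have hc : cmod (1 + w) / (c / 2) ^+ 2 * `|s n t - t ^+ 2| @[n -->
    \oo] --> 0.
    rewrite -[0 in X in _ --> X](mulr0 (cmod (1 + w) / (c / 2) ^+ 2)).
    apply: cvgMr; rewrite -[0 in X in _ --> X](@normr0 R R).
    apply: cvg_norm; rewrite -(subrr (t ^+ 2)).
    by apply: cvgB; [exact: s_cvg|exact: cvg_cst].
  apply: (squeeze_cvgr _ (cvg_cst 0) hc); apply: nearW => n /=.
  have [_ s0 _] := sP n.
  by rewrite cmod_ge0 levy_kernel_lipschitz// chle.
have hc : 2 * (cmod (z * mtilde lambda m) * cmod (levyD G (s n) w - levyD G sqr w))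
   @[n --> \oo] --> 0.
  rewrite -[0 in X in _ --> X](mulr0 2); apply: cvgMr.
  by rewrite -[0 in X in _ --> X](mulr0 (cmod (z * mtilde lambda m))); apply: cvgMr.
apply: (squeeze_cvgr _ (cvg_cst 0) hc); apply: nearW => n /=.
have cD : c / 12 <= 1 / 12 by rewrite ler_pM2r ?invr_gt0.
rewrite cmod_ge0 /= /fixstep -/w -cmodM mulrBr; apply: inv1B_dist.
  exact: le_trans (le_trans (cmod_fixE G hl c01 zc z01 (sP n) mc) zk) cD.
exact: le_trans (le_trans (cmod_fixE G hl c01 zc z01 (approx_sqr_sqr R) mc) zk) cD.
Qed.

(** Let m_n be the n-th iterate of S_n, the map built with the n-th simple function. Then m - S m is
    split in four: m against m_n, one further iteration (at most 2^-n), the contraction S_n m_n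
    against S_n m, and S_n m against S m. *)
Lemma fixstep_limit (U : set_system nat) (m : C) : ProperFilter U ->
  \oo `<=` U ->
  cmod (iter n (S (levyD G (s n))) 1 - m) @[n --> U] --> 0 ->
  cmod (m - 1) <= c / 6 /\ m = S (levyD G sqr) m.
Proof.
move=> FU ooU mU.
have [c0 c1] := andP c01.
pose mn n := iter n (S (levyD G (s n))) 1; rewrite -/mn in mU.
have mnc n : cmod (mn n - 1) <= c / 6 by exact: iter_fixstep_ball.
have small e : 0 < e -> \forall n \near U, cmod (m - mn n) <= e.
  move=> e0; move/cvgrPdistC_le: mU => /(_ e e0); apply: filterS => n.
  by rewrite subr0 cmod_distC ger0_norm ?cmod_ge0.
have mc : cmod (m - 1) <= c / 6.
  apply/ler_addgt0Pr => e e0.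
  have [n ne] := @filter_ex _ U _ _ (small e e0).
  rewrite (_ : m - 1 = (mn n - 1) + (m - mn n)); last by ring.
  by rewrite (le_trans (ler_cmodD _ _))// lerD.
split => //; apply/eqP; rewrite -subr_eq0 -cmod_eq0 eq_le cmod_ge0 andbT.
apply/ler_addgt0Pr => e e0; rewrite add0r.
have e4 : 0 < e / 4 by rewrite divr_gt0.
have geo : 2^-1 ^+ n @[n --> \oo] --> (0 : R).
  by apply: cvg_expr; rewrite ger0_norm ?invr_ge0// invf_lt1// ltr1n.
have h1 : \forall n \near U, `|2^-1 ^+ n : R| <= e / 4.
  apply: ooU; move/cvgrPdistC_le: geo => /(_ _ e4).
  by apply: filterS => n; rewrite subr0.
have h2 : \forall n \near U, cmod (S (levyD G (s n)) m - S (levyD G sqr) m) <= e / 4.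
  apply: ooU; move/cvgrPdistC_le: (cvg_fixstep mc) => /(_ _ e4).
  by apply: filterS => n; rewrite subr0 ger0_norm ?cmod_ge0.
have [n [[n1 n2] n3]] := @filter_ex _ U _ _ (filterI (filterI h1 h2) (small _ e4)).
have b2 : cmod (mn n - S (levyD G (s n)) (mn n)) <= e / 4.
  rewrite cmod_distC; apply: le_trans (le_trans (ler_norm _) n1).
  exact: (iter_fixstep_cauchy (G := G) hl c01 zc z01 (sP n) zk n).
have b3 : cmod (S (levyD G (s n)) (mn n) - S (levyD G (s n)) m) <= e / 4.
  apply: (le_trans (fixstep_contract (G := G) hl c01 zc z01 (sP n) zk (mnc n) mc)).
  rewrite cmod_distC; apply: le_trans n3.
  by rewrite ler_piMl ?cmod_ge0// invf_le1// ler1n.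
rewrite (_ : e = e / 4 + (e / 4 + (e / 4 + e / 4))); last by field.
apply: le_trans (ler_cmod_dist (mn n) _ _) (lerD n3 _).
apply: le_trans (ler_cmod_dist (S (levyD G (s n)) (mn n)) _ _) (lerD b2 _).
exact: le_trans (ler_cmod_dist (S (levyD G (s n)) m) _ _) (lerD b3 n2).
Qed.

End FixpointLimit.

(** * Quantile functions *)

Section UniformProbability.
Variable R : realType.
Local Notation RB := (measurableTypeR R).

Definition unif01 : probability RB R := uniform_prob (@ltr01 R).

Lemma unif01_itv (a b : R) : 0 <= a -> a <= b -> b <= 1 ->
  unif01 `[a, b[%classic = (b - a)%:E.
Proof.
move=> a0 ab b1; rewrite /unif01 /= /uniform_prob integral_uniform_pdf.
rewrite (eq_integral (fun=> 1%:E)); last first.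
  by move=> x; rewrite inE => -[_] /=; rewrite in_itv /= /uniform_pdf => ->;
    rewrite subr0 invr1.
rewrite integral_cst ?mul1e//; last exact: measurableI.
rewrite setIidl; last first.
  move=> x /=; rewrite !in_itv /= => /andP[ax xb].
  by rewrite (le_trans a0)//= (le_trans (ltW xb)).
rewrite [LHS]lebesgue_measure_itv /= lte_fin; case: ltgtP ab => // <- _.
by rewrite subrr.
Qed.

Local Notation I01 := (`[0%R, 1%R[%classic : set RB).

Lemma integral_unif01 (f : RB -> R) (M : R) : measurable_fun [set: RB] f ->
  (forall t, `|f t| <= M) ->
  \int[unif01]_t f t = \int[unif01]_(t in I01) f t.
Proof.
move=> mf fM.
rewrite -[X in Rintegral _ X f](setUv I01) Rintegral_setU//; last 3 first.
- exact: measurableC.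
- by rewrite setUv; exact: bounded_integrable mf fM.
- by apply/disj_setPS => x [h1]; exact.
rewrite [X in _ + X](_ : _ = 0) ?addr0// /Rintegral null_set_integral//.
- exact: measurableC.
- by apply/measurable_EFinP; exact: measurable_funTS.
have mI : measurable I01 by exact: measurable_itv.
apply: (etrans (probability_setC unif01 mI)).
by rewrite [X in (_ - X)%E](unif01_itv (lexx 0) ler01 (lexx 1)) subr0 -EFinB subrr.
Qed.

Lemma integral_unif01_split (f : RB -> R) (M a b c : R) :
  measurable_fun [set: RB] f -> (forall t, `|f t| <= M) -> a <= b -> b <= c ->
  \int[unif01]_(t in `[a, c[) f t =
  \int[unif01]_(t in `[a, b[) f t + \int[unif01]_(t in `[b, c[) f t.
Proof.
move=> mf fM ab bc; rewrite -Rintegral_setU//.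
- congr (Rintegral _ _ _); apply/seteqP; split => x /=; rewrite !in_itv /=.
    by move=> /andP[h1 h2]; case: (ltP x b) => xb; [left|right]; apply/andP.
  move=> [/andP[h1 h2]|/andP[h1 h2]].
    by rewrite h1 (lt_le_trans h2).
  by rewrite h2 (le_trans ab).
- apply: integrableS (bounded_integrable unif01 mf fM) => //.
  exact: measurableU.
- apply/disj_setPS => x /= []; rewrite !in_itv /= => /andP[_ h1] /andP[h2 _].
  by move: h1; rewrite ltNge h2.
Qed.

Lemma integral_unif01_cst (a b k : R) : 0 <= a -> a <= b -> b <= 1 ->
  \int[unif01]_(t in `[a, b[) k = k * (b - a).
Proof.
move=> a0 ab b1; rewrite Rintegral_cst//; congr (_ * _).
exact: (congr1 fine (unif01_itv a0 ab b1)).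
Qed.

Lemma integral_unif01_empty (f : RB -> R) (a : R) :
  \int[unif01]_(t in `[a, a[) f t = 0.
Proof. by rewrite set_itv_ge ?bnd_simp ?ltxx// Rintegral_set0. Qed.

(** [Q] is monotone on the whole line, which yields measurability, although the uniform law sees
    [0, 1] alone. The lower bound [a] serves the gluing in [quantile_discrete]. *)
Definition quantile_fun (a : R) (Q : R -> R) : Prop :=
  {homo Q : x y / x <= y} /\ forall x, a <= Q x <= 1.

(* Functions on [0, 1] need only be controlled there: [F \o Q] is then
   measurable and bounded for every quantile function [Q]. *)
Definition lipschitz01 (L : R) (f : R -> R) : Prop :=
  measurable_fun [set: RB] f /\ forall x y, 0 <= x <= 1 -> 0 <= y <= 1 ->
    `|f x - f y| <= L * `|x - y|.

Lemma quantile_measurable a Q : quantile_fun a Q ->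
  measurable_fun [set: RB] (Q : RB -> R).
Proof. by move=> [Qh _]; apply: nondecreasing_measurable => // x y; exact: Qh. Qed.

Lemma lipschitz01_ge0 L f : lipschitz01 L f -> 0 <= L.
Proof.
move=> [_ /(_ 0 1)]; rewrite !lexx ler01 => /(_ isT isT).
by rewrite sub0r normrN normr1 mulr1; apply: le_trans.
Qed.

Lemma lipschitz01_comp L f a Q : 0 <= a -> lipschitz01 L f -> quantile_fun a Q ->
  measurable_fun [set: RB] (fun t : RB => f (Q t)) /\
  forall t, `|f (Q t)| <= `|f 0| + L.
Proof.
move=> a0 fL Qq; have L0 := lipschitz01_ge0 fL; case: fL => mf fL; split.
  exact: (measurableT_comp mf (quantile_measurable Qq)).
move=> t; have /andP[q0 q1] := Qq.2 t.
have q01 : 0 <= Q t <= 1 by rewrite (le_trans a0 q0).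
rewrite -[f (Q t)](subrK (f 0)) (le_trans (ler_normD _ _))// addrC lerD2l.
rewrite (le_trans (fL _ 0 q01 _)) ?lexx ?ler01//.
by rewrite subr0 ler_piMr// ger0_norm; case/andP: q01.
Qed.

(** On each grid cell the error is at most L / M times the increase of Q, and these increases
    telescope to at most 1. The bound is thus the same for all quantile functions. *)
Lemma riemann_sum_quantile L f Q (M : nat) : lipschitz01 L f ->
  quantile_fun 0 Q -> (0 < M)%N ->
  `|\int[unif01]_t f (Q t) - M%:R^-1 * \sum_(l < M) f (Q (l%:R / M%:R))|
  <= L / M%:R.
Proof.
move=> fL Qq M0; have L0 := lipschitz01_ge0 fL.
have [mfQ bfQ] := lipschitz01_comp (lexx 0) fL Qq.
have Mp : 0 < M%:R :> R by rewrite ltr0n.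
rewrite (integral_unif01 mfQ bfQ).
have grid (l : nat) : (l <= M)%N -> 0 <= (l%:R / M%:R : R) <= 1.
  by move=> lM; rewrite divr_ge0//= ler_pdivrMr// mul1r ler_nat.
have step k : (k <= M)%N ->
   `|\int[unif01]_(t in `[0%R, (k%:R / M%:R)%R[) f (Q t)
     - M%:R^-1 * \sum_(l < k) f (Q (l%:R / M%:R))|
   <= L / M%:R * (Q (k%:R / M%:R) - Q 0).
  elim: k => [|k IH] kM.
    by rewrite mul0r integral_unif01_empty big_ord0 mulr0 !subrr normr0 mulr0.
  have /andP[k0 k1] := grid k (ltnW kM); have /andP[j0 j1] := grid k.+1 kM.
  have kj : k%:R / M%:R <= k.+1%:R / M%:R :> R.
    by rewrite ler_pM2r ?invr_gt0// ler_nat.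
  rewrite (integral_unif01_split mfQ bfQ k0 kj) big_ord_recr /= mulrDr opprD addrACA.
  rewrite (le_trans (ler_normD _ _))//.
  have -> : Q (k.+1%:R / M%:R) - Q 0 =
     (Q (k%:R / M%:R) - Q 0) + (Q (k.+1%:R / M%:R) - Q (k%:R / M%:R)) by ring.
  rewrite mulrDr lerD ?IH 1?ltnW//.
  have -> : M%:R^-1 * f (Q (k%:R / M%:R)) =
      \int[unif01]_(t in `[(k%:R / M%:R)%R, (k.+1%:R / M%:R)%R[) f (Q (k%:R / M%:R)).
    by rewrite integral_unif01_cst// -mulrBl -natrB// subSnn mul1r mulrC.
  have iQ (B : set RB) : measurable B -> unif01.-integrable B (EFin \o (fun t :
    RB => f (Q t))).
    by move=> mB; apply: integrableS (bounded_integrable unif01 mfQ bfQ).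
  rewrite -RintegralB//; [|exact: iQ|exact: finite_measure_integrable_cst].
  apply: (@le_trans _ _ (\int[unif01]_(t in `[(k%:R / M%:R)%R, (k.+1%:R / M%:R)%R[)
        (L * (Q (k.+1%:R / M%:R) - Q (k%:R / M%:R))))); last first.
    rewrite integral_unif01_cst// -mulrBl -natrB// subSnn mul1r.
    by rewrite mulrAC.
  have iD : unif01.-integrable `[(k%:R / M%:R)%R, (k.+1%:R / M%:R)%R[
      (EFin \o (fun t : RB => f (Q t) - f (Q (k%:R / M%:R)))).
    apply: (@integrableB _ _ _ _ _ _ (EFin \o (fun t : RB => f (Q t))) (EFin \o
      cst (f (Q (k%:R / M%:R))))) => //; first exact: iQ.
    exact: finite_measure_integrable_cst.
  rewrite (le_trans (le_normr_Rintegral _ _))// le_Rintegral//.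
  - exact: (integrable_norm iD).
  - exact: finite_measure_integrable_cst.
  move=> x; rewrite /= in_itv /= => /andP[kx xj].
  have [Qh Q01] := Qq; rewrite (le_trans (fL.2 _ _ (Q01 _) (Q01 _)))//.
  rewrite ler_wpM2l// ger0_norm ?subr_ge0 ?Qh//.
  by rewrite lerB// Qh// ltW.
have := step M (leqnn M); rewrite divff ?gt_eqF// => /le_trans; apply.
rewrite -[leRHS]mulr1 ler_wpM2l ?divr_ge0//.
have [_ Q01] := Qq; have /andP[_ h1] := Q01 1; have /andP[h0 _] := Q01 0.
by rewrite lerBlDr (le_trans h1)// lerDl.
Qed.

(** Induction on the sorted atoms. [c] is the mass already placed, so that the rest lives on [c, 1[,
    which is empty when no atom is left. [a] bounds the remaining values from below; this keeps the
    function monotone when the head value is put to the left of c + p. *)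
Lemma quantile_discrete (l : seq (R * R)) (c a : R) :
  (forall x, x \in l -> 0 <= x.1 /\ a <= x.2 <= 1) -> 0 <= a <= 1 -> 0 <= c ->
  sorted (relpre snd <=%R) l -> c + \sum_(x <- l) x.1 = 1 ->
  exists2 Q, quantile_fun a Q & forall L f, lipschitz01 L f ->
    \int[unif01]_(t in `[c, 1%R[) f (Q t) = \sum_(x <- l) x.1 * f x.2.
Proof.
elim: l c a => [|[p th] l IH] c a lP /andP[a0 a1] c0 srt.
  rewrite big_nil addr0 => ->; exists (fun=> 1).
    by split => [//|x]; rewrite a1 lexx.
  by move=> L f fL; rewrite integral_unif01_empty big_nil.
rewrite big_cons /= addrA => sum1.
have [p0 /andP[ath th1]] : 0 <= p /\ a <= th <= 1 by apply: (lP (p, th));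
  rewrite mem_head.
have tr : transitive (relpre (@snd R R) <=%R) by move=> x y z /=; exact: le_trans.
have [||||Q [Qh Q01] QE] := IH (c + p) th _ _ _ _ sum1.
- move=> x xl; have [x1 /andP[x2 x3]] : 0 <= x.1 /\ a <= x.2 <= 1 by apply: lP;
    rewrite inE xl orbT.
  split => //; rewrite x3 andbT.
  by have /allP/(_ x xl) := order_path_min tr srt.
- by rewrite (le_trans a0 ath).
- exact: addr_ge0.
- exact: path_sorted srt.
have qq : quantile_fun a (fun x => if x < c + p then th else Q x).
  split => [x y xy|x].
    case: (ltP x (c + p)) => xc; case: (ltP y (c + p)) => yc //.
    - by have /andP[] := Q01 y.
    - by move: yc; rewrite ltNge (le_trans xc xy).
    - exact: Qh.
  case: ifP => _; first by rewrite ath.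
  by have /andP[h ->] := Q01 x; rewrite (le_trans ath h).
exists (fun x => if x < c + p then th else Q x) => // L f fL.
have [mfQ bfQ] := lipschitz01_comp a0 fL qq.
have cp1 : c + p <= 1.
  rewrite -sum1 lerDl big_seq sumr_ge0// => x xl.
  by have [] := lP x _ => //; rewrite inE xl orbT.
have ccp : c <= c + p by rewrite lerDl.
rewrite (integral_unif01_split mfQ bfQ ccp cp1) big_cons /=; congr (_ + _).
  rewrite (@eq_Rintegral _ _ _ _ _ (fun=> f th)).
    by rewrite integral_unif01_cst// addrAC subrr add0r mulrC.
  by move=> x; rewrite inE /= in_itv /= => /andP[_ ->].
rewrite -(QE _ _ fL); apply: eq_Rintegral => x.
by rewrite inE /= in_itv /= => /andP[h _]; rewrite ltNge h.
Qed.

Lemma quantile_of_discrete d (p th : 'I_d -> R) : (forall j, 0 <= p j) ->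
  (forall j, 0 <= th j <= 1) -> \sum_j p j = 1 ->
  exists2 Q, quantile_fun 0 Q & forall L f, lipschitz01 L f ->
    \int[unif01]_t f (Q t) = \sum_j p j * f (th j).
Proof.
move=> p0 th01 p1.
pose l0 := [seq (p j, th j) | j <- index_enum 'I_d].
pose l := sort (relpre snd <=%R) l0.
have pl : perm_eq l l0 by rewrite perm_sort.
have [|||||Q Qq QE] := @quantile_discrete l 0 0.
- move=> x; rewrite (perm_mem pl) => /mapP[j _ ->] /=; split; first exact: p0.
  exact: th01.
- by rewrite lexx ler01.
- by [].
- by apply: sort_sorted => x y /=; exact: le_total.
- by rewrite add0r (perm_big _ pl) /= big_map.
exists Q => // L f fL; have [mfQ bfQ] := lipschitz01_comp (lexx 0) fL Qq.
by rewrite (integral_unif01 mfQ bfQ) (QE _ _ fL) (perm_big _ pl) /= big_map.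
Qed.

(** Dominated convergence being tied to sequences, the integrals are compared through Riemann sums:
    finitely many point values converge along [U], and the discretisation error is uniform in n. *)
Lemma ultra_quantile_limit (U : set_system nat) (Q : nat -> R -> R) :
  UltraFilter U -> (forall n, quantile_fun 0 (Q n)) ->
  exists2 Q0, quantile_fun 0 Q0 & forall L f, lipschitz01 L f ->
    \int[unif01]_t f (Q n t) @[n --> U] --> \int[unif01]_t f (Q0 t).
Proof.
move=> UU Qq.
have lim x : exists q : R, 0 <= q <= 1 /\ Q n x @[n --> U] --> q.
  have [|q [q01 qc]] := @segment_compact R 0 1 (Q n x @[n --> U]) _.
    by apply: nearW => n /=; rewrite in_itv /=; exact: (Qq n).2.
  exists q; split; first by move: q01; rewrite /= in_itv.
  (* A cluster point of an ultrafilter is its limit: otherwise the complement of the preimage of [A]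
     would belong to [U], against clustering. *)
  move=> A Aq; have [//|UnA] := in_ultra_setVsetC ((fun n => Q n x) @^-1` A) UU.
  have [y [nAy Ay]] := qc (~` A) A UnA Aq.
  by case: nAy.
have [Q0 Q0P] := choice lim.
have qQ0 : quantile_fun 0 Q0.
  split => [x y xy|x]; last by have [] := Q0P x.
  apply: (ler_cvg_to (Q0P x).2 (Q0P y).2).
  by apply: nearW => n; exact: (Qq n).1.
exists Q0 => // L f fL.
apply/cvgrPdistC_le => e e0.
have L0 := lipschitz01_ge0 fL.
pose M := (Num.truncn (3 * L / e)).+1.
have Mp : 0 < M%:R :> R by rewrite ltr0n.
have LM : L / M%:R <= e / 3.
  have : 3 * L / e < M%:R by exact: truncnS_gt.
  rewrite ltr_pdivrMr// => /ltW h.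
  by rewrite ler_pdivrMr// mulrAC ler_pdivlMr// mulrC [e * _]mulrC.
have e3L : 0 < e / 3 by rewrite divr_gt0.
have sc : M%:R^-1 * \sum_(l < M) f (Q n (l%:R / M%:R)) @[n --> U] -->
          M%:R^-1 * \sum_(l < M) f (Q0 (l%:R / M%:R)).
  apply: cvgMr; apply: cvg_big => [|l _]; first exact: add_continuous.
  have [h0 h1] := Q0P (l%:R / M%:R).
  apply/cvgrPdistC_le => e' e'0.
  have e'L : 0 < e' / (L + 1) by rewrite divr_gt0// ltr_wpDl.
  move/cvgrPdistC_le: h1 => /(_ _ e'L); apply: filterS => n hn.
  rewrite (le_trans (fL.2 _ _ ((Qq n).2 _) h0))//.
  apply: (@le_trans _ _ ((L + 1) * (e' / (L + 1)))).
    by rewrite ler_pM// lerDl.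
  by rewrite mulrC divfK// gt_eqF// ltr_wpDl.
move/cvgrPdistC_le: sc => /(_ _ e3L); apply: filterS => n hn.
have r1 := riemann_sum_quantile fL (Qq n) (ltn0Sn _ : (0 < M)%N).
have r0 := riemann_sum_quantile fL qQ0 (ltn0Sn _ : (0 < M)%N).
move: hn r1 r0; set a := \int[_]_t _; set b := \int[_]_t _.
set u := _^-1 * _; set v := _^-1 * _ => uv au bv.
rewrite (_ : a - b = (a - u) + (u - v) + (v - b)); last by ring.
rewrite (_ : e = e / 3 + e / 3 + e / 3); last by field.
rewrite (le_trans (ler_normD _ _))// lerD//.
  by rewrite (le_trans (ler_normD _ _))// lerD// (le_trans au).
by rewrite distrC (le_trans bv).
Qed.

End UniformProbability.

(** * The kernel in the compactified variable *)

Section ResolventKernel.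
Variable R : realType.
Local Notation C := R[i].
Local Notation RB := (measurableTypeR R).

(** At s = 1 / |z| the cone inequality demands a modulus of at least 2 c, whereas 1 - z s = 0 there
    if z > 0. *)
Lemma cone_not_ge0 (c : R) (z : C) : 0 < c -> cone c z -> z != 0 -> ~~ (0 <= z).
Proof.
move=> c0 zc zN0; apply/negP => z0.
have zE : z = (cmod z)%:C by rewrite -normc_cmod ger0_norm.
have cz : 0 < cmod z by rewrite cmod_gt0.
have := zc (cmod z)^-1; rewrite invr_ge0 cmod_ge0 => /(_ isT).
rewrite divff ?gt_eqF// {1}zE -rmorphM /= divff ?gt_eqF// subrr cmod0.
by apply/negP; rewrite -ltNge mulr_gt0.
Qed.

(* With [s = (1 - th) / th] this is [1 / (1 - z s)]: the change of variable
   compactifies [0, +oo] to [0, 1], with [th = 0] at infinity. *)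
Definition rkernel (z : C) (th : R) : C := th%:C / (th%:C - z * (1 - th)%:C).

Lemma rkernel_inv (z : C) (a : R) : ~~ (0 <= z) ->
  (1 - z * (a ^+ 2)%:C)^-1 = rkernel z (1 + a ^+ 2)^-1.
Proof.
move=> z0; have a1 : (1 + a ^+ 2)%:C != 0 :> C.
  by rewrite -cmod_gt0 cmodR normr_gt0 gt_eqF// ltr_wpDr ?sqr_ge0.
have d0 : 1 - z * (a ^+ 2)%:C != 0.
  rewrite subr_eq0; apply: contraNneq z0 => e.
  have a0 : (a ^+ 2)%:C != 0 :> C.
    by apply/eqP => a0; move/eqP: e; rewrite a0 mulr0 oner_eq0.
  by rewrite -[z](mulfK a0) -e mul1r invr_ge0 ler0c sqr_ge0.
rewrite /rkernel !rmorphB /= !fmorphV /= -/((1 + a ^+ 2)%:C).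
set A := (1 + a ^+ 2)%:C; set x := (a ^+ 2)%:C.
have AE : A = 1 + x by rewrite /A rmorphD /= rmorph1.
have -> : A^-1 - z * (1 - A^-1) = A^-1 * (1 - z * x).
  have -> : x = A - 1 by rewrite AE; ring.
  have {}a1 : A != 0 := a1.
  by clearbody A; field.
by rewrite invfM mulrA divff ?mul1r// invr_eq0.
Qed.

(** The cone inequality at s = (1 - th) / th, multiplied by th, gives the lower bound c (th + |z| (1
    - th)), which is at least c |z| since |z| <= 1. At th = 0 the claim reduces to c <= 1, the cone
    inequality at s = 0. *)
Lemma rkernel_den (c : R) (z : C) (th : R) : 0 < c -> cone c z ->
  0 < cmod z <= 1 -> 0 <= th <= 1 ->
  c * cmod z <= cmod (th%:C - z * (1 - th)%:C).
Proof.
move=> c0 zc /andP[z0 z1] /andP[t0 t1].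
have [->|tN0] := eqVneq th 0.
  have := zc 0 (lexx 0); rewrite !mulr0 addr0 subr0 cmod1 mulr1 => c1.
  by rewrite !subr0 mulr1 sub0r cmodN ler_piMl ?cmod_ge0.
have tp : 0 < th by rewrite lt_def tN0.
have s0 : 0 <= (1 - th) / th by rewrite divr_ge0// subr_ge0.
have -> : th%:C - z * (1 - th)%:C = th%:C * (1 - z * ((1 - th) / th)%:C).
  by rewrite mulrBr mulr1 mulrCA -rmorphM /= [th * _]mulrC divfK.
rewrite cmodM cmodR ger0_norm// -ler_pdivrMl// (le_trans _ (zc _ s0))//.
rewrite mulrCA ler_pM2l// -ler_pdivlMl ?invr_gt0// invrK.
rewrite mulrDr mulr1 mulrCA [th * (_ / _)]mulrC divfK//.
have : 0 <= th * (1 - cmod z) by rewrite mulr_ge0// subr_ge0.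
lra.
Qed.

Lemma rkernel_dist (c : R) (z : C) (x y : R) : 0 < c -> cone c z ->
  0 < cmod z <= 1 -> 0 <= x <= 1 -> 0 <= y <= 1 ->
  cmod (rkernel z x - rkernel z y) <= cmod z / (c * cmod z) ^+ 2 * `|x - y|.
Proof.
move=> c0 zc z01 x01 y01; have [z0 z1] := andP z01.
have dx := rkernel_den c0 zc z01 x01; have dy := rkernel_den c0 zc z01 y01.
have cz : 0 < c * cmod z by rewrite mulr_gt0.
rewrite /rkernel; set X := x%:C - _ in dx *; set Y := y%:C - _ in dy *.
have Xn : X != 0 by rewrite -cmod_gt0 (lt_le_trans cz).
have Yn : Y != 0 by rewrite -cmod_gt0 (lt_le_trans cz).
have -> : x%:C / X - y%:C / Y = z * (y - x)%:C / (X * Y).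
  have -> : x%:C / X - y%:C / Y = (x%:C * Y - y%:C * X) / (X * Y).
    by field; rewrite Xn Yn.
  by congr (_ / _); rewrite /X /Y !rmorphB /=; ring.
rewrite !cmodM cmodV cmodM cmodR [`|y - x|]distrC mulrAC ler_wpM2r//.
rewrite ler_wpM2l ?cmod_ge0// lef_pV2 ?posrE ?(exprn_gt0 _ cz) ?mulr_gt0 ?cmod_gt0//.
by rewrite expr2 ler_pM// ltW.
Qed.

Lemma cmeasurable_rkernel (z : C) (q : RB -> R) : measurable_fun [set: RB] q ->
  cmeasurable (fun t => rkernel z (q t)).
Proof.
move=> mq; apply: cmeasurableM; first exact: cmeasurableR.
apply: cmeasurableV; apply: cmeasurableD; first exact: cmeasurableR.
apply: cmeasurableN; apply: cmeasurableM; first exact: cmeasurable_cst.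
by apply: cmeasurableR; apply: measurable_funB.
Qed.

Lemma rkernel_lipschitz01 (c : R) (z : C) : 0 < c -> cone c z ->
  0 < cmod z <= 1 ->
  lipschitz01 (cmod z / (c * cmod z) ^+ 2) (fun th => complex.Re (rkernel z th)) /\
  lipschitz01 (cmod z / (c * cmod z) ^+ 2) (fun th => complex.Im (rkernel z th)).
Proof.
move=> c0 zc z01.
have mid : measurable_fun [set: RB] (fun t : RB => t : R) by exact: measurable_id.
have [mr mi] := cmeasurable_rkernel z mid.
split; split => // x y x01 y01.
  rewrite -ReN -ReD (le_trans (ler_Re_cmod _))//; exact: rkernel_dist.
rewrite -ImN -ImD (le_trans (ler_Im_cmod _))//; exact: rkernel_dist.
Qed.

Lemma cbounded_rkernel (c : R) (z : C) (Q : R -> R) : 0 < c -> cone c z ->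
  0 < cmod z <= 1 -> quantile_fun 0 Q -> cbounded (fun t : RB => rkernel z (Q t)).
Proof.
move=> c0 zc z01 Qq; split.
  exact: (cmeasurable_rkernel z (quantile_measurable Qq)).
exists (cmod z / (c * cmod z) ^+ 2) => t.
have q01 := Qq.2 t.
have := rkernel_dist c0 zc z01 q01 (_ : 0 <= 0 <= 1).
rewrite lexx ler01 => /(_ isT); rewrite {2}/rkernel mul0r subr0 => /le_trans; apply.
rewrite subr0 ger0_norm; last by case/andP: q01.
case/andP: q01 => q0 q1; rewrite -[leRHS]mulr1 ler_wpM2l//.
by rewrite divr_ge0 ?cmod_ge0 ?sqr_ge0.
Qed.

End ResolventKernel.

(** * One quantile function for all z *)

Section LimitTransform.
Variable R : realType.
Local Notation C := R[i].
Local Notation RB := (measurableTypeR R).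
Variable G : {finite_measure set RB -> \bar R}.
Variable lambda : R.
Hypothesis hl : 0 <= lambda <= 1.

Local Notation sqr := (fun t : RB => t ^+ 2).

(** The weights and poles of an iterate do not depend on z, so each iterate has one quantile
    function valid for all z. The limit along a single ultrafilter then keeps [Q] ahead of [c] and
    [z]; it applies to the real and imaginary parts of the kernel, both Lipschitz in th. *)
Lemma fixpoint_quantile : exists2 Q : R -> R, quantile_fun 0 Q &
  forall (c : R) (z : C), 0 < c <= 1 -> cone c z -> 0 < cmod z <= 1 ->
    32 / c ^+ 2 * kappa G (cmod z) <= c / 12 ->
    let m := cintegral (unif01 R) (fun t => rkernel z (Q t)) in
    cmod (m - 1) <= c / 6 /\ m = fixstep lambda (levyD G sqr) z m.
Proof.
have [s [sP s_cvg sl]] := sqr_approximation G.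
pose mn n z := iter n (fixstep lambda (levyD G (s n)) z) 1.
have mnE n : exists2 Q, quantile_fun 0 Q & forall (c : R) (z : C),
   0 < c -> cone c z -> 0 < cmod z <= 1 ->
   mn n z = cintegral (unif01 R) (fun t => rkernel z (Q t)).
  have [l [lP lE]] := sl n.
  have [d [p [a [p0 p1 pE]]]] := fixstep_discrete n hl lP.
  have th01 j : 0 <= (1 + a j ^+ 2)^-1 <= 1.
    have h : 0 <= a j ^+ 2 by exact: sqr_ge0.
    by rewrite invr_ge0 addr_ge0//= invf_le1 ?ltr_wpDr// lerDl.
  have [Q Qq QE] := quantile_of_discrete p0 th01 p1.
  exists Q => // c z c0 zc z01; have [z0 _] := andP z01.
  have zn : ~~ (0 <= z) by apply: (cone_not_ge0 c0 zc); rewrite -cmod_gt0.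
  have [lr li] := rkernel_lipschitz01 c0 zc z01.
  rewrite /cintegral (QE _ _ lr) (QE _ _ li) /mn.
  have -> : levyD G (s n) = atomicD l by apply/funext => w; exact: lE.
  rewrite pE//; under eq_bigr do rewrite rkernel_inv//.
  apply/eqP; rewrite eq_complex /=; apply/andP; split.
    rewrite (big_morph _ (@ReD R) (_ : complex.Re 0 = 0))//.
    apply/eqP/eq_bigr => j _.
    by case: (rkernel _ _) => x y /=; rewrite mul0r subr0.
  rewrite (big_morph _ (@ImD R) (_ : complex.Im 0 = 0))//.
  apply/eqP/eq_bigr => j _.
  by case: (rkernel _ _) => x y /=; rewrite mul0r addr0.
have /choice[Q QP] n : exists Qn, quantile_fun 0 Qn /\
    forall (c : R) (z : C), 0 < c -> cone c z -> 0 < cmod z <= 1 ->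
    mn n z = cintegral (unif01 R) (fun t => rkernel z (Qn t)).
  by have [Qn h1 h2] := mnE n; exists Qn.
have [U [UU ooU]] := ultraFilterLemma (eventually_filter : ProperFilter \oo).
have [Q0 Q0q Q0P] := ultra_quantile_limit UU (fun n => (QP n).1).
exists Q0 => // c z c01 zc z01 zk m; have [c0 c1] := andP c01.
have [lr li] := rkernel_lipschitz01 c0 zc z01.
apply: (@fixstep_limit _ G lambda hl c z c01 zc z01 zk s sP s_cvg U) => //.
apply/cvgrPdistC_le => e e0.
have e2 : 0 < e / 2 by rewrite divr_gt0.
have /cvgrPdistC_le/(_ _ e2) hr := Q0P _ _ lr.
have /cvgrPdistC_le/(_ _ e2) hi := Q0P _ _ li.
apply: filterS (filterI hr hi) => n [nr ni].
rewrite subr0 ger0_norm ?cmod_ge0// -/(mn n z) ((QP n).2 c z c0 zc z01).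
rewrite (le_trans (ler_cmod_ReIm _))// ReD ReN ImD ImN.
by rewrite (_ : e = e / 2 + e / 2) ?lerD//; field.
Qed.

End LimitTransform.

(** * The symmetric law *)

Section HalfSum.
Variable R : realType.
Local Notation RB := (measurableTypeR R).
Variables P1 P2 : probability RB R.

Lemma half_ge0 : (0 : R) <= 2^-1.
Proof. by rewrite invr_ge0. Qed.

Definition half_sum : set RB -> \bar R :=
  measure_add (mscale (NngNum half_ge0) P1) (mscale (NngNum half_ge0) P2).

HB.instance Definition _ := Measure.on half_sum.

Lemma half_sumE A : half_sum A = ((2^-1)%:E * P1 A + (2^-1)%:E * P2 A)%E.
Proof. exact: measure_addE. Qed.

Let half_sum1 : half_sum [set: RB] = 1%:E.
Proof.
by rewrite half_sumE !probability_setT !mule1 -EFinD; congr EFin; field.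
Qed.

HB.instance Definition _ := Measure_isProbability.Build _ _ _ half_sum half_sum1.

Lemma ge0_integral_half_sum (f : RB -> \bar R) : measurable_fun [set: RB] f ->
  (forall t, 0 <= f t)%E ->
  (\int[half_sum]_t f t = (2^-1)%:E * (\int[P1]_t f t + \int[P2]_t f t))%E.
Proof.
move=> mf f0.
rewrite ge0_integral_measure_add// !ge0_integral_mscale//.
by rewrite -muleDr ?ge0_adde_def ?inE ?integral_ge0.
Qed.

End HalfSum.

Section SymmetricLaw.
Variable R : realType.
Local Notation C := R[i].
Local Notation RB := (measurableTypeR R).
Variable P : probability RB R.

(** Adding M makes a function bounded by M nonnegative, so that the assumed identity applies; M then
    cancels because all measures involved have mass 1. *)
Lemma Rintegral_half_add (mu : probability RB R) (X Y : RB -> RB) :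
  measurable_fun [set: RB] X -> measurable_fun [set: RB] Y ->
  (forall f : RB -> \bar R, measurable_fun [set: RB] f -> (forall t, 0 <= f t)%E ->
    (\int[mu]_t f t = (2^-1)%:E * (\int[P]_t f (X t) + \int[P]_t f (Y t)))%E) ->
  forall (f : RB -> R) (M : R), measurable_fun [set: RB] f ->
    (forall t, `|f t| <= M) ->
    \int[mu]_t f t = 2^-1 * (\int[P]_t f (X t) + \int[P]_t f (Y t)).
Proof.
move=> mX mY muE f M mf fM.
have mcomp Z : measurable_fun [set: RB] Z -> measurable_fun [set: RB] (fun t => f
  (Z t)).
  by move=> mZ; exact: (measurableT_comp mf mZ).
have shift (nu : probability RB R) (g : RB -> R) : measurable_fun [set: RB] g ->
    (forall t, `|g t| <= M) -> \int[nu]_t (g t + M) = \int[nu]_t g t + M.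
  move=> mg gM; rewrite RintegralD//.
  - rewrite Rintegral_cst// [X in _ + _ * X](_ : _ = 1) ?mulr1//.
    exact: (congr1 fine (probability_setT nu)).
  - exact: bounded_integrable mg gM.
  - exact: finite_measure_integrable_cst.
have pos t : 0 <= f t + M.
  by rewrite -lerBlDr sub0r lerNnormlW.
apply: (@addIr _ M); rewrite -(shift mu)//.
have fin Z : measurable_fun [set: RB] Z ->
    (\int[P]_t (f (Z t) + M)%:E = (\int[P]_t (f (Z t) + M))%:E)%E.
  move=> mZ; rewrite /Rintegral fineK//; apply: integrable_fin_num => //.
  apply: (@bounded_integrable _ _ _ (M + `|M|)) => [|t].
    by apply: measurable_funD => //; exact: mcomp.
  by rewrite (le_trans (ler_normD _ _))// lerD2r.
rewrite /Rintegral muE; last 2 first.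
- by apply/measurable_EFinP; exact: measurable_funD.
- by move=> t; rewrite lee_fin.
rewrite !fin// -EFinD -EFinM /= !shift//; [|exact: mcomp|exact: mcomp].
rewrite -![fine _]/(Rintegral _ _ _); by field.
Qed.

(** [mu] is the law of X multiplied by an independent fair sign. *)
Lemma symmetric_law (X : RB -> R) : measurable_fun [set: RB] X ->
  exists2 mu : probability RB R, symmetric_measure mu &
    forall F : RB -> C, cbounded F -> cintegral mu F =
      2^-1 * (cintegral P (fun t => F (X t)) + cintegral P (fun t => F (- X t))).
Proof.
move=> mX.
have mX' : measurable_fun [set: RB] (X : RB -> RB) by exact: mX.
have mNX : measurable_fun [set: RB] ((fun t => - X t) : RB -> RB).
  exact: (measurable_funN mX).
pose X1 : {mfun RB >-> RB} := @mfun_Sub _ _ RB RB X (mem_set mX').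
pose X2 : {mfun RB >-> RB} := @mfun_Sub _ _ RB RB (fun t => - X t) (mem_set mNX).
pose mu : probability RB R := half_sum (distribution P X1) (distribution P X2).
exists mu.
  move=> A mA; apply: (etrans (half_sumE _ _ _));
    apply: (etrans _ (esym (half_sumE _ _ _))).
  rewrite addeC; congr (_ * P _ + _ * P _)%E.
  by apply/seteqP; split => t /=; rewrite opprK.
have muE (f : RB -> \bar R) : measurable_fun [set: RB] f -> (forall t, 0 <= f t)%E ->
    (\int[mu]_t f t = (2^-1)%:E * (\int[P]_t f (X t) + \int[P]_t f (- X t)%R))%E.
  move=> mf f0.
  by rewrite (ge0_integral_half_sum _ _ mf f0) !ge0_integral_distribution.
move=> F [[mr mi] [M FM]].
have rM t : `|complex.Re (F t)| <= M by exact: le_trans (ler_Re_cmod _) (FM t).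
have iM t : `|complex.Im (F t)| <= M by exact: le_trans (ler_Im_cmod _) (FM t).
rewrite /cintegral.
rewrite (Rintegral_half_add mX' mNX muE mr rM) (Rintegral_half_add mX' mNX muE mi
  iM).
have -> : (2^-1 : C) = (2^-1)%:C by rewrite fmorphV rmorph_nat.
apply/eqP; rewrite eq_complex /=.
by rewrite /= !mul0r subr0 addr0 !eqxx.
Qed.

End SymmetricLaw.

(** * From the quantile function to the law on the line *)

Section LevyLaw.
Variable R : realType.
Local Notation C := R[i].
Local Notation RB := (measurableTypeR R).

Lemma sqr_sqrt_neg (z : C) : sqrt_neg z ^+ 2 = z.
Proof. by rewrite /sqrt_neg exprMn sqr_sqrtc sqr_i mulN1r opprK. Qed.

Lemma eq_cintegral_null (mu : {finite_measure set RB -> \bar R}) (N : set RB)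
    (f g : RB -> C) : measurable N -> mu N = 0%E -> cmeasurable f -> cmeasurable g ->
  (forall t, ~ N t -> f t = g t) -> cintegral mu f = cintegral mu g.
Proof.
move=> mN N0 [f1 f2] [g1 g2] fg; rewrite /cintegral /Rintegral.
congr (Complex (fine _) (fine _)); apply: ae_eq_integral => //.
- exact/measurable_EFinP.
- exact/measurable_EFinP.
- by exists N; split => // t /= h; apply: contrapT => Nt; apply: h; rewrite fg.
- exact/measurable_EFinP.
- exact/measurable_EFinP.
- by exists N; split => // t /= h; apply: contrapT => Nt; apply: h; rewrite fg.
Qed.

Variable G : {finite_measure set RB -> \bar R}.
Variable lambda : R.
Hypothesis hl : 0 <= lambda <= 1.
Local Notation sqr := (fun t : RB => t ^+ 2).

Lemma cone_neg (r : R) : 0 < r -> cone 1 (- r%:C : C).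
Proof.
move=> r0 s s0; rewrite cmodN cmodR ger0_norm ?(ltW r0)// mul1r.
have -> : 1 - - r%:C * s%:C = (1 + r * s)%:C :> C.
  by rewrite rmorphD rmorphM rmorph1 /=; ring.
by rewrite cmodR ler_norm.
Qed.

(** On the negative half-line the kernel is the real number Q / (Q + r (1 - Q)), at most 1 and equal
    to 0 where Q = 0. So Re m(-r) is at most the mass of {Q <> 0}, while the fixed-point equation
    puts m(-r) within 2 e of 1. *)
Lemma quantile_eq0_null (Q : R -> R) : quantile_fun 0 Q ->
  (forall (c : R) (z : C), 0 < c <= 1 -> cone c z -> 0 < cmod z <= 1 ->
    32 / c ^+ 2 * kappa G (cmod z) <= c / 12 ->
    let m := cintegral (unif01 R) (fun t => rkernel z (Q t)) in
    cmod (m - 1) <= c / 6 /\ m = fixstep lambda (levyD G sqr) z m) ->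
  unif01 R [set t : RB | Q t = 0] = 0%E.
Proof.
move=> Qq QP.
have mQ := quantile_measurable Qq.
pose N := [set t : RB | Q t = 0].
have mN : measurable N.
  have -> : N = [set: RB] `&` Q @^-1` [set 0] by rewrite setTI.
  by apply: mQ => //; exact: measurable_set1.
suff h : forall e : R, 0 < e -> e <= 1 / 12 -> 1 - 2 * e <= fine (unif01 R (~` N)).
  have pc : unif01 R (~` N) = (1 - unif01 R N)%E by exact: probability_setC.
  have fN : unif01 R N \is a fin_num by exact: fin_num_measure.
  rewrite pc -(fineK fN) -EFinB /= in h.
  have : fine (unif01 R N) <= 0.
    apply/ler_addgt0Pr => e e0; rewrite add0r.
    pose e' := Num.min (e / 2) (1 / 12).
    have e'0 : 0 < e' by rewrite lt_min !divr_gt0.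
    have := h e' e'0; rewrite ge_min lexx orbT => /(_ isT).
    have : e' <= e / 2 by rewrite ge_min lexx.
    lra.
  move=> le0; apply/eqP; rewrite -(fineK fN) eqe eq_le le0.
  by rewrite fine_ge0.
move=> e e0 e1.
(* Dividing by 32 absorbs the constant 32 / c^2 at c = 1, the cone constant of the negative
   half-line. *)
have e32 : 0 < e / 32 by rewrite divr_gt0.
have [b /andP[b0 b1] bP] := kappa_small G e32.
pose r := b / 2.
have r0 : 0 < r by rewrite divr_gt0.
have rb : 0 < r < b by rewrite r0/= ltr_pdivrMr// ltr_pMr// ltr1n.
have kr := bP _ rb.
have zr : cmod (- r%:C : C) = r by rewrite cmodN cmodR ger0_norm// ltW.
have z01 : 0 < cmod (- r%:C : C) <= 1.
  by rewrite zr r0 (le_trans (ltW (andP rb).2)).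
have c01 : 0 < (1 : R) <= 1 by rewrite ltr01 lexx.
have zc := cone_neg r0.
have Ek : 32 / 1 ^+ 2 * kappa G (cmod (- r%:C : C)) <= e.
  by rewrite zr expr1n divr1 -ler_pdivlMl// mulrC.
have [mc mE] := QP 1 _ c01 zc z01 (le_trans Ek e1).
set m := cintegral _ _ in mc mE.
have m1 : cmod (m - 1) <= 2 * e.
  have fE := le_trans (cmod_fixE G hl c01 zc z01 (approx_sqr_sqr R) mc) Ek.
  (* m = 1 / (1 - E) with |E| <= e is compared with 1 = 1 / (1 - 0). *)
  have := inv1B_dist (le_trans fE e1) (_ : cmod (0 : C) <= 1 / 12).
  rewrite cmod0 divr_ge0// => /(_ isT); rewrite !subr0 invr1.
  rewrite {1}/fixE -/(fixstep lambda (levyD G sqr) (- r%:C) m) -mE => /le_trans;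
    apply.
  by rewrite ler_pM2l.
have : 1 - 2 * e <= complex.Re m.
  have := le_trans (ler_Re_cmod _) m1; rewrite ReD ReN /= ler_norml => /andP[+ _].
  lra.
move=> /le_trans; apply.
have -> : complex.Re m = \int[unif01 R]_t complex.Re (rkernel (- r%:C) (Q t)) by [].
have -> : fine (unif01 R (~` N)) = \int[unif01 R]_t (\1_(~` N) t).
  by rewrite /Rintegral integral_indic ?setIT//; exact: measurableC.
have bk := cbounded_rkernel ltr01 zc z01 Qq.
have [ir _] := cbounded_integrable (unif01 R) bk.
apply: le_Rintegral => //.
  apply: (@bounded_integrable _ _ _ 1) => [|t].
    by apply: measurable_indic; exact: measurableC.
  by rewrite indicE ger0_norm// lern1 leq_b1.
move=> t _; have /andP[q0 q1] := Qq.2 t.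
have rE : rkernel (- r%:C) (Q t) = (Q t / (Q t + r * (1 - Q t)))%:C.
  by rewrite /rkernel mulNr opprK !(rmorphM, fmorphV, rmorphD).
rewrite rE indicE /=; have [tN|tN] := boolP (t \in ~` N); last first.
  have -> : Q t = 0 by apply: contrapT => h; move/negP: tN; apply; rewrite inE.
  by rewrite mul0r.
have rq : 0 <= r * (1 - Q t) by rewrite mulr_ge0 ?subr_ge0// ltW.
have [->|qn] := eqVneq (Q t) 0; first by rewrite mul0r.
have qp : 0 < Q t by rewrite lt_def qn.
by rewrite ler_pdivrMr ?ltr_wpDr// mul1r lerDl.
Qed.

(** With q = [sqrt_neg z] and u = 1 / q, symmetry turns the Cauchy kernel into (1 / (u - x) + 1 / (u
    + x)) / 2 = q / (1 - z x^2). Hence G_mu(u) = q m, and H_mu(z) = lambda q^2 m^2 + (1 - lambda)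
    q^2 m = z m mtilde. *)
Lemma levy_law : exists2 mu : probability RB R, symmetric_measure mu &
  forall (c : R) (z : C), 0 < c <= 1 -> cone c z -> 0 < cmod z <= 1 ->
    32 / c ^+ 2 * kappa G (cmod z) <= c / 12 ->
    exists m, [/\ cmod (m - 1) <= c / 6, m = fixstep lambda (levyD G sqr) z m &
      rectH lambda mu z = z * m * mtilde lambda m].
Proof.
have [Q Qq QP] := fixpoint_quantile G hl.
have N0 := quantile_eq0_null Qq QP.
have mQ := quantile_measurable Qq.
(* This solves Q = 1 / (1 + X^2). Where Q = 0 the convention 1 / 0 = 0 gives X = 0, on a null set by
   [N0]. *)
pose X (t : RB) : R := Num.sqrt ((1 - Q t) / Q t).
have mX : measurable_fun [set: RB] X.
  have ms : measurable_fun [set: RB] (@Num.sqrt R).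
    by apply: nondecreasing_measurable => // x y xy; exact: ler_wsqrtr.
  apply: (measurableT_comp ms); apply: measurable_funM.
    exact: measurable_funB.
  by apply: measurable_inv_ge0 => // t; case/andP: (Qq.2 t).
have [mu smu muE] := symmetric_law (unif01 R) mX.
exists mu => // c z c01 zc z01 zk.
have [mc mE] := QP c z c01 zc z01 zk.
set m := cintegral _ _ in mc mE.
exists m; split => //.
have [c0 _] := andP c01; have [z0 _] := andP z01.
have zN0 : z != 0 by rewrite -cmod_gt0.
have zn : ~~ (0 <= z) by exact: (cone_not_ge0 c0 zc).
set q := sqrt_neg z.
have q2 : q ^+ 2 = z by exact: sqr_sqrt_neg.
have qN0 : q != 0 by apply: contraNneq zN0 => q0; rewrite -q2 q0 expr0n.
pose u := q^-1.
(* A real u would make z = u^-2 nonnegative. The Cauchy kernel at u is then bounded by 1 / |Im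
   u|. *)
have iu : 0 < `|complex.Im u|.
  rewrite normr_gt0; apply: contraNneq zn => iu0.
  have ur : u \is Num.real by rewrite [u]complexE iu0 mulr0 addr0;
    apply/complex_realP; exists (complex.Re u).
  by rewrite -q2 -[q]invrK -/u exprVn invr_ge0 real_exprn_even_ge0.
have mF : cmeasurable (fun t : RB => (u - (t : R)%:C)^-1).
  apply: cmeasurableV; apply: cmeasurableD; first exact: cmeasurable_cst.
  by apply: cmeasurableN; apply: cmeasurableR; exact: measurable_id.
have uF t : `|complex.Im u| <= cmod (u - t%:C).
  by apply: le_trans (ler_Im_cmod _); rewrite ImD ImN /= subr0.
have bF : cbounded (fun t : RB => (u - (t : R)%:C)^-1).
  split => //; exists (`|complex.Im u|^-1) => t.
  by rewrite cmodV lef_pV2 ?posrE// (lt_le_trans iu).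
have un t : u - t%:C != 0 by rewrite -cmod_gt0 (lt_le_trans iu).
have GE : cauchyG mu u = q * m.
  rewrite /cauchyG muE// /m -cintegralZ; last exact: (cbounded_rkernel c0 zc z01 Qq).
  have bXY (Y : RB -> R) : measurable_fun [set: RB] Y ->
      cbounded (fun t : RB => (u - (Y t)%:C)^-1).
    move=> mY; split; last by case: bF => _ [M MF]; exists M => t.
    apply: cmeasurableV; apply: cmeasurableD; first exact: cmeasurable_cst.
    by apply: cmeasurableN; apply: cmeasurableR.
  have mNX : measurable_fun [set: RB] (fun t => - X t) by exact: measurable_funN.
  rewrite -cintegralD; [|exact: bXY|exact: bXY].
  rewrite -cintegralZ; last by apply: cboundedD; exact: bXY.
  have mN : measurable [set t : RB | Q t = 0].
    have -> : [set t : RB | Q t = 0] = [set: RB] `&` Q @^-1` [set 0] by rewrite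
      setTI.
    by apply: mQ => //; exact: measurable_set1.
  apply: (eq_cintegral_null mN N0).
  - by apply: cmeasurableM; [exact: cmeasurable_cst|apply: cmeasurableD;
      exact: (bXY _ _).1].
  - by apply: cmeasurableM; [exact: cmeasurable_cst|exact: cmeasurable_rkernel].
  move=> t /= Qt; have qn : Q t != 0 by apply/eqP.
  have /andP[q0 q1] := Qq.2 t.
  have X2 : X t ^+ 2 = (1 - Q t) / Q t.
    by rewrite sqr_sqrtr// divr_ge0// subr_ge0.
  have QE : Q t = (1 + X t ^+ 2)^-1.
    by rewrite X2 (_ : 1 + _ = (Q t)^-1) ?invrK//; field.
  rewrite QE -rkernel_inv// rmorphXn /= rmorphN /=.
  have n1 := un (X t); have := un (- X t); rewrite rmorphN opprK => n2.
  have uq : u * q = 1 by rewrite /u mulVf.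
  have -> : 1 - z * (X t)%:C ^+ 2 = q ^+ 2 * ((u - (X t)%:C) * (u + (X t)%:C)).
    rewrite -subr_sqr mulrBr -exprMn [q * u]mulrC uq expr1n q2; ring.
  have uN0 : u != 0 by rewrite invr_eq0.
  have -> : q = u^-1 by rewrite /u invrK.
  rewrite /=; move: n1 n2 uN0; generalize u (X t)%:C => v x n1 n2 vN0.
  by field; rewrite n1 n2 vN0.
rewrite /rectH -/q -/u GE /mtilde.
rewrite exprMn q2 -mulrA [q * (q * m)]mulrA -expr2 q2; ring.
Qed.

End LevyLaw.

(** * The inverse germ *)

Section Sectors.
Variable R : realType.
Local Notation C := R[i].

Lemma arg_bounds (z : C) : z != 0 ->
  cos (arg z) = complex.Re z / cmod z /\ 0 <= arg z <= 2 * pi.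
Proof.
move=> z0; have cz : 0 < cmod z by rewrite cmod_gt0.
have x1 : -1 <= complex.Re z / cmod z <= 1.
  by rewrite -ler_norml normrM normfV (ger0_norm (ltW cz)) ler_pdivrMr// mul1r
    ler_Re_cmod.
have a0 := acos_ge0 x1; have a1 := acos_lepi x1; have p0 := pi_ge0 R.
rewrite /arg; case: ifP => _; split.
- by rewrite acosK// in_itv.
- by rewrite a0/=; lra.
- rewrite cosB mulr_natl cos2pi sin2pi mul0r addr0 mul1r.
  by rewrite acosK// in_itv.
- by lra.
Qed.

(** cos decreases on [0, pi], and cos (arg z - pi) = - Re z / |z|. *)
Lemma argBpi (z : C) (alpha : R) : z != 0 -> 0 < alpha < pi ->
  (`|arg z - pi| < alpha) = (cos alpha * cmod z < - complex.Re z).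
Proof.
move=> z0 /andP[a0 api]; have [ca /andP[b0 b1]] := arg_bounds z0.
have cz : 0 < cmod z by rewrite cmod_gt0.
rewrite -[LHS]ltr_cos; last 2 first.
- by rewrite in_itv /= normr_ge0 /= ler_norml; lra.
- by rewrite in_itv /= (ltW a0) (ltW api).
rewrite cos_norm cosB cospi sinpi mulr0 addr0 mulrN1 ca -mulNr.
by rewrite ltr_pdivlMr.
Qed.

Lemma Delta_sector (alpha beta : R) (z : C) : Delta alpha beta z ->
  sector alpha z /\ 0 < cmod z < beta.
Proof. by move=> [za zb]; split => //; split => //; rewrite -cmod_gt0;
  case/andP: zb. Qed.

(** This is cos(alpha / 2)^2. *)
Definition sector_cst (alpha : R) : R := (1 + cos alpha) / 2.

Lemma cosN1_lt (alpha : R) : 0 < alpha < pi -> -1 < cos alpha.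
Proof.
move=> /andP[a0 api]; rewrite -cospi ltr_cos// in_itv /=; apply/andP; split;
  rewrite ?lexx ?pi_ge0//; exact: ltW.
Qed.

Lemma sector_cst01 (alpha : R) : 0 < alpha < pi -> 0 < sector_cst alpha <= 1.
Proof.
move=> /cosN1_lt ha; have := cos_le1 alpha; rewrite /sector_cst => h1.
by apply/andP; split; lra.
Qed.

(** With x = s |z| and c = [sector_cst alpha], |1 - z s|^2 >= 1 + 2 x cos alpha + x^2 = c (1 + x)^2
    + (1 - c) (1 - x)^2, and c >= c^2. *)
Lemma sector_cone (alpha : R) (z : C) : 0 < alpha < pi -> sector alpha z ->
  cone (sector_cst alpha) z.
Proof.
move=> ha [z0]; rewrite argBpi// => zr s s0.
have /andP[c0 c1] := sector_cst01 ha.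
have ca : cos alpha = 2 * sector_cst alpha - 1 by rewrite /sector_cst; field.
rewrite -(@ler_pXn2r _ 2) ?nnegrE ?cmod_ge0//; last first.
  by rewrite mulr_ge0 ?(ltW c0)// addr_ge0 ?mulr_ge0 ?cmod_ge0.
have sq : cmod (1 - z * s%:C) ^+ 2 = 1 - 2 * s * complex.Re z + (s * cmod z) ^+ 2.
  rewrite exprMn !cmodE !sqr_sqrtr ?addr_ge0 ?sqr_ge0//.
  by case: z {z0 zr} => a b /=; ring.
rewrite {}sq.
have x0 : 0 <= s * cmod z by rewrite mulr_ge0 ?cmod_ge0.
have h1 : s * (cos alpha * cmod z) <= s * (- complex.Re z) by rewrite ler_wpM2l//
  ltW.
rewrite ca in h1; move: (sector_cst alpha) c0 c1 h1 => c c0 c1 h1.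
rewrite [cmod z * s]mulrC.
have h2 : (s * cmod z) * (2 * c - 1) <= - (s * complex.Re z).
  by rewrite -mulrN -mulrA [cmod z * _]mulrC.
have h3 : (c * (1 + s * cmod z)) ^+ 2 <= c * (1 + s * cmod z) ^+ 2.
  by rewrite exprMn ler_wpM2r ?sqr_ge0// expr2 ler_piMl// ltW.
apply: le_trans h3 _.
have h4 : 0 <= (1 - c) * (1 - s * cmod z) ^+ 2 by rewrite mulr_ge0 ?sqr_ge0//
  subr_ge0.
rewrite -subr_ge0; rewrite -subr_ge0 in h2.
have -> : 1 - 2 * s * complex.Re z + (s * cmod z) ^+ 2 - c * (1 + s * cmod z) ^+ 2
  = (1 - c) * (1 - s * cmod z) ^+ 2 + 2 * (- (s * complex.Re z) - s * cmod z * (2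
    * c - 1)) by ring.
by rewrite addr_ge0// mulr_ge0.
Qed.

(** Passing from z to z q changes the real part and the modulus by at most |z| |q - 1| each, and
    each change may use half of the gap cos alpha - cos alpha'. The inverse germ moves points by
    such a factor q, so sectors must be allowed to open slightly. *)
Lemma sector_perturb (alpha alpha' : R) : 0 < alpha < pi -> 0 < alpha' < pi ->
  alpha < alpha' -> exists2 d, 0 < d & forall z q : C, sector alpha z ->
    cmod (q - 1) <= d -> z * q != 0 -> `|arg (z * q) - pi| < alpha'.
Proof.
move=> ha ha' aa'.
have cc : cos alpha' < cos alpha.
  have [/andP[a0 a1] /andP[b0 b1]] := (ha, ha').
  by rewrite ltr_cos ?in_itv//= ?(ltW a0) ?(ltW a1) ?(ltW b0) ?(ltW b1).
exists ((cos alpha - cos alpha') / 2); first by rewrite divr_gt0// subr_gt0.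
move=> z q [z0]; rewrite argBpi// => zr qd zq; rewrite argBpi//.
have cz := cmod_ge0 z.
have e1 : z * q = z + z * (q - 1) by ring.
have h1 : - complex.Re z - cmod z * ((cos alpha - cos alpha') / 2) <= -
  complex.Re (z * q).
  rewrite e1 ReD opprD lerD2l lerN2 (le_trans (ler_norm _))// (le_trans
    (ler_Re_cmod _))//.
  by rewrite cmodM ler_wpM2l.
have h2 : cos alpha' * cmod (z * q) <= cos alpha' * cmod z + cmod z * ((cos alpha
  - cos alpha') / 2).
  have k1 : `|cmod (z * q) - cmod z| <= cmod z * ((cos alpha - cos alpha') / 2).
    apply: (@le_trans _ _ (cmod (z * (q - 1)))); last by rewrite cmodM ler_wpM2l.
    have t1 := ler_cmodD z (z * (q - 1)); have t2 := lerB_cmod z (z * (q - 1)).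
    rewrite e1 ler_norml; lra.
  rewrite -lerBlDl -mulrBr (le_trans (ler_norm _))// normrM.
  by apply: le_trans k1; rewrite ler_piMl// cos_max.
have h3 : cmod z * ((cos alpha - cos alpha') / 2) + cmod z * ((cos alpha - cos
  alpha') / 2)
   = cos alpha * cmod z - cos alpha' * cmod z by field.
move: h1 h2 h3 zr; move: (cmod z * _) (cos alpha * _) (_ * cmod z) => x y w.
lra.
Qed.

End Sectors.

(** * Differentiability from a bound on difference quotients *)

Section ComplexDerivative.
Variable R : realType.
Local Notation C := R[i].

Lemma gt0_complex (e : C) : 0 < e -> e = (complex.Re e)%:C /\ 0 < complex.Re e.
Proof.
move=> e0; have eE : e = (complex.Re e)%:C by rewrite RRe_real// gtr0_real.
by split => //; rewrite -ltcR -eE.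
Qed.

Lemma near_cball (z : C) (r : R) : 0 < r ->
  \forall w \near (z : C^o), cmod (w - z) < r.
Proof.
move=> r0; apply/nbhs_normP; exists r%:C => /=; first by rewrite ltcR.
by move=> w /=; rewrite distrC normc_cmod ltcR.
Qed.

Lemma cdifferentiable_of_bound (f : C -> C) (z d : C) (r K : R) : 0 < r ->
  (forall h, 0 < cmod h < r -> cmod ((f (z + h) - f z) / h - d) <= K * cmod h) ->
  cdifferentiable f z.
Proof.
move=> r0 hf; apply/cvg_ex; exists d; apply/cvgrPdistC_le => e /gt0_complex[-> e0].
have K1 : 0 < `|K| + 1 by rewrite ltr_wpDl.
have e1 : 0 < Num.min r (complex.Re e / (`|K| + 1)) by rewrite lt_min r0 divr_gt0.
apply/nbhs_normP; exists (Num.min r (complex.Re e / (`|K| + 1)))%:C.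
  by rewrite /= ltcR.
move=> h /=; rewrite sub0r normrN normc_cmod ltcR lt_min => /andP[hr he] hN0.
rewrite normc_cmod lecR.
have := hf h; rewrite cmod_gt0 hN0 hr => /(_ isT).
rewrite mulrC [h *: _]mulr1 [h + z]addrC => /le_trans; apply.
apply: (@le_trans _ _ ((`|K| + 1) * cmod h)).
  by rewrite ler_wpM2r ?cmod_ge0// (le_trans (ler_norm _))// lerDl.
by rewrite -ler_pdivlMl// mulrC ltW.
Qed.

End ComplexDerivative.

(** * Regularity and size of the candidate inverse *)

Section InverseGerm.
Variable R : realType.
Local Notation C := R[i].
Local Notation RB := (measurableTypeR R).
Variable G : {finite_measure set RB -> \bar R}.
Local Notation sqr := (fun t : RB => t ^+ 2).

Lemma levyD_cdifferentiable (c : R) (z : C) : 0 < c -> cone c z -> 0 < cmod z ->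
  cdifferentiable (levyD G sqr) z.
Proof.
move=> c0 zc r0.
have [msq sq0 _] := approx_sqr_sqr R.
set r := cmod z in r0.
have rN0 : r != 0 by rewrite gt_eqF.
have zN0 : z != 0 by rewrite -cmod_gt0.
have c20 : 0 < c / 2 by rewrite divr_gt0.
have den x : 0 <= x -> c / 2 * (1 + r * x) <= cmod (1 - z * x%:C).
  move=> x0; apply: le_trans (zc _ x0);
    rewrite ler_wpM2r// ?addr_ge0 ?mulr_ge0 ?cmod_ge0//.
  by rewrite ler_pdivrMr// ler_peMr ?(ltW c0)// ler1n.
have bk : cbounded (fun t : RB => (1 + t ^+ 2)%:C / (1 - z * (t ^+ 2)%:C)).
  exact: (cbounded_levyD msq sq0 c20 r0 den).
have dpos x : 0 <= x -> 0 < 1 + r * x.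
  by move=> x0; rewrite ltr_wpDr// mulr_ge0// ltW.
have bs : cbounded (fun t : RB => (t ^+ 2)%:C / (1 - z * (t ^+ 2)%:C)).
  split.
    apply: cmeasurableM; first exact: cmeasurableR.
    apply: cmeasurableV; apply: cmeasurableD; first exact: cmeasurable_cst.
    apply: cmeasurableN; apply: cmeasurableM; first exact: cmeasurable_cst.
    exact: cmeasurableR.
  exists (r^-1 / (c / 2)) => t; have x0 := sq0 t; have dx := den _ x0.
  rewrite cmodM cmodV cmodR ger0_norm//.
  have d1 : 0 < cmod (1 - z * (t ^+ 2)%:C) by apply: lt_le_trans dx;
    rewrite mulr_gt0// dpos.
  rewrite ler_pdivrMr// mulrAC ler_pdivlMr// ler_pdivlMl//.
  apply: (@le_trans _ _ (c / 2 * (1 + r * (t ^+ 2 : R)))) => //.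
  rewrite (_ : r * (_ * _) = c / 2 * (r * t ^+ 2)); last by ring.
  by rewrite ler_pM2l// lerDr.
pose d := cintegral G (fun t => ((1 + t ^+ 2)%:C / (1 - z * (t ^+ 2)%:C)) *
    ((t ^+ 2)%:C / (1 - z * (t ^+ 2)%:C))).
(* One factor for each of the three kernels left in the remainder of the difference quotient. *)
pose K := (1 + r^-1) / (c / 2) * (r^-1 / (c / 2)) * (r^-1 / (c / 2)).
(* Below this radius |h / z| <= c / 2, so z + h = z (1 + h / z) keeps cone constant c / 2. *)
apply: (@cdifferentiable_of_bound _ _ z d (c / 2 * r) (2 * (K * fine (G [set:
  RB])))).
  by rewrite mulr_gt0.
move=> h /andP[h0 hr].
have hN0 : h != 0 by rewrite -cmod_gt0.
have denw x : 0 <= x -> c / 2 * (1 + r * x) <= cmod (1 - (z + h) * x%:C).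
  move=> x0; have -> : z + h = z * (1 + h / z) by rewrite mulrDr mulr1 mulrC divfK.
  apply: cone_perturb => //; rewrite addrAC subrr add0r cmodM cmodV.
  by rewrite ler_pdivrMr// ltW.
have bw : cbounded (fun t : RB => (1 + t ^+ 2)%:C / (1 - (z + h) * (t ^+ 2)%:C)).
  exact: (cbounded_levyD msq sq0 c20 r0 denw).
have bd := cboundedM bk bs.
have bdiff := cboundedD bw (cboundedN bk).
have bh := cboundedM (cbounded_cst h^-1) bdiff.
rewrite /levyD /d mulrC -cintegralB// -cintegralZ// -cintegralB//.
have cst0 : 2 * (K * fine (G [set: RB])) * cmod h = 2 * \int[G]_t (K * cmod h).
  by rewrite Rintegral_cst//; ring.
rewrite cst0; apply: le_cmod_cintegral.
- exact: cboundedD bh (cboundedN bd).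
- exact: finite_measure_integrable_cst.
move=> t; have x0 := sq0 t; have dz := den _ x0; have dw := denw _ x0.
have dp := mulr_gt0 c20 (dpos _ x0).
move: x0 dz dw dp; set x := t ^+ 2 => x0 dz dw dp.
have nz : 1 - z * x%:C != 0 by rewrite -cmod_gt0 (lt_le_trans dp).
have nw : 1 - (z + h) * x%:C != 0 by rewrite -cmod_gt0 (lt_le_trans dp).
set k := (1 + x)%:C.
have -> : h^-1 * (k / (1 - (z + h) * x%:C) - k / (1 - z * x%:C))
      - k / (1 - z * x%:C) * (x%:C / (1 - z * x%:C))
   = h * (k / (1 - z * x%:C)) * (x%:C / (1 - z * x%:C)) * (x%:C / (1 - (z + h) *
     x%:C)).
  by field; rewrite nz nw hN0.
have xb (w : C) : c / 2 * (1 + r * x) <= cmod (1 - w * x%:C) ->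
    cmod (x%:C / (1 - w * x%:C)) <= r^-1 / (c / 2).
  move=> dx; have d1 := lt_le_trans dp dx.
  rewrite cmodM cmodV cmodR ger0_norm//.
  rewrite ler_pdivrMr// mulrAC ler_pdivlMr// ler_pdivlMl//.
  apply: (@le_trans _ _ (c / 2 * (1 + r * x))) => //.
  rewrite (_ : r * (_ * _) = c / 2 * (r * x)); last by ring.
  by rewrite ler_pM2l// lerDr.
have b1 := levy_kernel_bound c20 r0 x0 dz.
have := xb _ dw; have := xb _ dz; rewrite -/k in b1; move: b1.
generalize (k / (1 - z * x%:C)) (x%:C / (1 - z * x%:C)) (x%:C / (1 - (z + h) *
  x%:C)).
move=> k1 a b h1 h2 h3.
rewrite (_ : cmod (h * k1 * a * b) = cmod k1 * cmod a * cmod b * cmod h); last first.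
  by rewrite !cmodM; ring.
rewrite ler_wpM2r ?cmod_ge0// /K ler_pM ?mulr_ge0 ?cmod_ge0//.
by rewrite ler_pM ?cmod_ge0.
Qed.

(** At m = 1 the factor mtilde is 1, so C(z) is the value there of [fixE], taken with lambda = 0. *)
Lemma levyC_bound (c : R) (z : C) : 0 < c <= 1 -> cone c z -> 0 < cmod z <= 1 ->
  cmod (levyC G z) <= 32 / c ^+ 2 * kappa G (cmod z).
Proof.
move=> c01 zc z01; have l01 : 0 <= (0 : R) <= 1 by rewrite lexx ler01.
have := cmod_fixE G l01 c01 zc z01 (approx_sqr_sqr R) (m := 1).
rewrite subrr cmod0 /fixE mtilde1 !mulr1; apply.
by case/andP: c01 => c0 _; rewrite divr_ge0// ltW.
Qed.

Lemma levyC_small (alpha e : R) : 0 < alpha < pi -> 0 < e ->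
  exists2 b, 0 < b <= 1 & forall z, sector alpha z -> cmod z < b ->
    cmod (levyC G z) <= e.
Proof.
move=> ha e0; have c01 := sector_cst01 ha; set c := sector_cst alpha in c01.
have [c0 _] := andP c01.
have e'0 : 0 < e / (32 / c ^+ 2) by rewrite divr_gt0// divr_gt0// exprn_gt0.
have [b b01 bP] := kappa_small G e'0; exists b => // z zs zb.
have z0 : 0 < cmod z by rewrite cmod_gt0; case: zs.
have [b0 b1] := andP b01.
have z01 : 0 < cmod z <= 1 by rewrite z0 (le_trans (ltW zb)).
apply: (le_trans (levyC_bound c01 (sector_cone ha zs) z01)).
rewrite mulrC -ler_pdivlMr ?divr_gt0 ?exprn_gt0//.
by apply: bP; rewrite z0.
Qed.

Variable lambda : R.
Hypothesis hl : 0 <= lambda <= 1.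

Definition levy_hden (z : C) : C := (1 + levyC G z) * mtilde lambda (1 + levyC G z).
Definition levy_hinv (z : C) : C := z / levy_hden z.

Lemma cmod_hden1 (z : C) (d : R) : cmod (levyC G z) <= d -> d <= 1 ->
  cmod (levy_hden z - 1) <= 3 * d.
Proof.
move=> zd d1; apply: cmod_mul_mtilde1 => //.
by rewrite addrAC subrr add0r.
Qed.

(** d <= 1 / 36 brings 3 d into the range 1 / 12 of [inv1B_dist], which then doubles it to 6 d. *)
Lemma hden_ratio (z : C) (d : R) : cmod (levyC G z) <= d -> d <= 1 / 36 ->
  levy_hden z != 0 /\ cmod ((levy_hden z)^-1 - 1) <= 6 * d.
Proof.
move=> zd d36; have d1 : d <= 1 by lra.
have h := cmod_hden1 zd d1.
split.
  have := lerB_cmod 1 (levy_hden z - 1); rewrite cmod1 addrCA subrr addr0 => h2.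
  by rewrite -cmod_gt0; lra.
have e1 : cmod (1 - levy_hden z) <= 1 / 12 by rewrite cmod_distC; lra.
have e2 : cmod (0 : C) <= 1 / 12 by rewrite cmod0 divr_ge0.
have := inv1B_dist e1 e2; rewrite opprB addrCA subrr addr0 !subr0 invr1 cmod_distC.
by move=> /le_trans; apply; rewrite cmod_distC; lra.
Qed.

Lemma hinv_small (alpha e : R) : 0 < alpha < pi -> 0 < e ->
  exists2 b, 0 < b <= 1 & forall z, sector alpha z -> cmod z < b ->
    [/\ levy_hden z != 0, cmod ((levy_hden z)^-1 - 1) <= e & cmod (levyC G z) <= e].
Proof.
move=> ha e0.
have d0 : 0 < Num.min (e / 6) (1 / 36) by rewrite lt_min !divr_gt0.
have [b b01 bP] := levyC_small ha d0; exists b => // z zs zb.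
have Cz := bP z zs zb.
have de : Num.min (e / 6) (1 / 36) <= e / 6 by rewrite ge_min lexx.
have d36 : Num.min (e / 6) (1 / 36) <= 1 / 36 by rewrite ge_min lexx orbT.
have [h1 h2] := hden_ratio Cz d36.
by split => //; lra.
Qed.

Lemma hinv_cvg (alpha : R) : 0 < alpha < pi ->
  (fun z : C^o => (levy_hinv z / z : C^o))
    @ within (sector alpha) (nbhs (0 : C^o)) --> (1 : C^o).
Proof.
move=> ha; apply/cvgrPdistC_le => e /gt0_complex[-> e0].
have [b /andP[b0 b1] bP] := hinv_small ha e0.
rewrite near_withinE; apply: filterS (near_cball 0 b0) => z; rewrite subr0 => zb zs.
have [h1 h2 _] := bP z zs zb.
rewrite normc_cmod lecR /levy_hinv mulrAC divff ?mul1r//.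
by case: zs.
Qed.

Lemma cderivable_hinv (c : R) (z : C) : 0 < c -> cone c z -> z != 0 ->
  levy_hden z != 0 -> cdifferentiable levy_hinv z.
Proof.
move=> c0 zc z0 hz.
have dD := levyD_cdifferentiable c0 zc (_ : 0 < cmod z).
rewrite cmod_gt0 in dD; have {}dD := dD z0.
have did : derivable (id : C^o -> C^o) (z : C^o) 1 by exact: derivable_id.
have dcst (k : C) : derivable (cst k : C^o -> C^o) (z : C^o) 1 by exact:
  derivable_cst.
have dC : derivable (levyC G : C^o -> C^o) z 1 := derivableM did dD.
have d1 : derivable ((fun z => 1 + levyC G z) : C^o -> C^o) z 1 := derivableD
  (dcst 1) dC.
have d2 : derivable ((fun z => mtilde lambda (1 + levyC G z)) : C^o -> C^o) z 1.
  exact: derivableD (derivableM (dcst lambda%:C) d1) (dcst (1 - lambda)%:C).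
have d3 : derivable (levy_hden : C^o -> C^o) z 1 := derivableM d1 d2.
exact: derivableM did (derivableV hz d3).
Qed.

End InverseGerm.

(** * The inverse of H and the R-transform of the law *)

Section RectangularTransform.
Variable R : realType.
Local Notation C := R[i].
Local Notation RB := (measurableTypeR R).
Variable G : {finite_measure set RB -> \bar R}.
Variable lambda : R.
Hypothesis hl : 0 <= lambda <= 1.
Local Notation sqr := (fun t : RB => t ^+ 2).
Local Notation hinv := (levy_hinv G lambda).
Local Notation hden := (levy_hden G lambda).

Variable mu : probability RB R.
Hypothesis muP : forall (c : R) (z : C), 0 < c <= 1 -> cone c z ->
  0 < cmod z <= 1 -> 32 / c ^+ 2 * kappa G (cmod z) <= c / 12 ->
  exists m, [/\ cmod (m - 1) <= c / 6, m = fixstep lambda (levyD G sqr) z m &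
      rectH lambda mu z = z * m * mtilde lambda m].

Lemma kappa_near0 (c : R) : 0 < c <= 1 -> exists2 b, 0 < b <= 1 &
  forall r, 0 < r < b -> 32 / c ^+ 2 * kappa G r <= c / 12.
Proof.
move=> /andP[c0 c1].
have e0 : 0 < c / 12 / (32 / c ^+ 2) by rewrite !divr_gt0// exprn_gt0.
have [b b01 bP] := kappa_small G e0; exists b => // r rb.
by rewrite mulrC -ler_pdivlMr ?divr_gt0 ?exprn_gt0// bP.
Qed.

Lemma near1_neq0 (m : C) (e : R) : cmod (m - 1) <= e -> e < 1 -> m != 0.
Proof.
move=> me e1; apply: contraTneq me => ->.
by rewrite sub0r cmodN cmod1 -ltNge.
Qed.

Lemma hinv_rectH : near0_sectors (fun z => hinv (rectH lambda mu z) = z).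
Proof.
move=> alpha ha; have c01 := sector_cst01 ha.
have [b /andP[b0 b1] bP] := kappa_near0 c01; exists b => // z /Delta_sector[zs zb].
have z01 : 0 < cmod z <= 1 by case/andP: zb => -> /ltW/le_trans ->.
have [m [mc mE ->]] := muP c01 (sector_cone ha zs) z01 (bP _ zb).
have [c0 c1] := andP c01.
have c6 : sector_cst alpha / 6 < 1 by lra.
have m0 := near1_neq0 mc c6.
have mt0 := near1_neq0 (cmod_mtilde1 hl mc) c6.
have CE : levyC G (z * m * mtilde lambda m) = m - 1.
  set w := z * m * _.
  have e1 : m * (1 - z * mtilde lambda m * levyD G sqr w) = 1.
    rewrite [X in X * _]mE /fixstep -/w mulVf//.
    by apply: contraNneq m0 => h; rewrite mE /fixstep -/w h invr0.
  rewrite -[in RHS]e1 /levyC -/(levyD G sqr w) {1}/w; ring.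
by rewrite /levy_hinv /levy_hden CE addrCA subrr addr0 -(mulrA z) mulfK// mulf_neq0.
Qed.

(** At z = hinv w both the m supplied for [mu] and 1 + C(w) solve the fixed-point equation and lie
    in the disc of uniqueness. So they agree, and H_mu(z) = z m mtilde = w. *)
Lemma rectH_hinv : near0_sectors (fun w => rectH lambda mu (hinv w) = w).
Proof.
move=> alpha ha; have /andP[c0 c1] := sector_cst01 ha.
set c := sector_cst alpha in c0 c1.
have c18 : c / 18 <= 1 by rewrite ler_pdivrMr// mul1r (le_trans c1)// ler1n.
(* c / 3 is the cone constant at hinv w: the perturbation of w turns c into c / 2, and replacing |w|
   by |hinv w| <= 3/2 |w| costs a further factor 2/3. *)
have c301 : 0 < c / 3 <= 1 by apply/andP; split; lra.
have [b2 /andP[b20 b21] b2P] := kappa_near0 c301.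
(* c / 18 = (c / 3) / 6 is the radius of the uniqueness disc for the cone constant c / 3. *)
have e0 : 0 < c / 18 by rewrite divr_gt0.
have [b1 /andP[b10 b11] b1P] := hinv_small G hl ha e0.
exists (Num.min b1 (b2 / 2)); first by rewrite lt_min b10 divr_gt0.
move=> w /Delta_sector[ws /andP[w0]]; rewrite lt_min => /andP[wb1 wb2].
have [hw qw Cw] := b1P w ws wb1.
have wN0 : w != 0 by rewrite -cmod_gt0.
have [q0 q2] : hden w != 0 /\ cmod (hden w)^-1 <= 2.
  by split => //; apply: cmod_le2; exact: le_trans qw c18.
have z0 : hinv w != 0 by rewrite mulf_neq0// invr_eq0.
have zw : cmod (hinv w) <= 2 * cmod w.
  by rewrite cmodM mulrC ler_wpM2r ?cmod_ge0.
have zb : 0 < cmod (hinv w) < b2.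
  by rewrite cmod_gt0 z0 /=; lra.
have z01 : 0 < cmod (hinv w) <= 1 by case/andP: zb => -> /ltW/le_trans ->.
have zc : cone (c / 3) (hinv w).
  move=> s s0; apply: le_trans (cone_perturb (sector_cone ha ws) s0 _);
    last by rewrite -/c; lra.
  rewrite -/c.
  have h1 : cmod (hinv w) <= 3 / 2 * cmod w.
    rewrite cmodM mulrC ler_wpM2r ?cmod_ge0//.
    rewrite -[(hden w)^-1](subrK 1) (le_trans (ler_cmodD _ _))// cmod1; lra.
  rewrite (_ : c / 2 * _ = c / 3 * (3 / 2 + 3 / 2 * cmod w * s)); last by field.
  have h2 : cmod (hinv w) * s <= 3 / 2 * cmod w * s by rewrite ler_wpM2r.
  by rewrite ler_wpM2l//; lra.
have [m [mc mE ->]] := muP c301 zc z01 (b2P _ zb).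
pose m' := 1 + levyC G w.
have mc' : cmod (m' - 1) <= c / 3 / 6 by rewrite /m' addrAC subrr add0r; lra.
have m'0 : m' != 0 by apply: near1_neq0 mc' _; lra.
have zm : hinv w * m' * mtilde lambda m' = w.
  by rewrite -mulrA -/(hden w) divfK.
have mE' : m' = fixstep lambda (levyD G sqr) (hinv w) m'.
  rewrite /fixstep zm.
  have -> : hinv w * mtilde lambda m' = w / m'.
    by apply: (mulIf m'0); rewrite divfK// mulrAC.
  have -> : w / m' * levyD G sqr w = levyC G w / m' by rewrite mulrAC.
  have -> : levyC G w = m' - 1 by rewrite /m' addrAC subrr add0r.
  by rewrite mulrBl divff// mul1r opprB addrCA subrr addr0 invrK.
have -> : m = m'.
  exact: (fixstep_unique hl c301 zc z01 (approx_sqr_sqr R) (b2P _ zb) mc mc' mE mE').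
exact: zm.
Qed.

Lemma hinv_is_rectHinv : is_rectHinv lambda mu hinv.
Proof.
split.
- move=> alpha ha; have [b /andP[b0 _] bP] := hinv_small G hl ha ltr01.
  exists b => // z /Delta_sector[zs /andP[z0 zb]].
  have [hz _ _] := bP z zs zb; have /andP[c0 _] := sector_cst01 ha.
  by apply: (cderivable_hinv c0 (sector_cone ha zs)) => //; case: zs.
- by move=> alpha ha; exact: hinv_cvg.
- exact: rectH_hinv.
- exact: hinv_rectH.
Qed.

(** [rectHinv] is an arbitrary choice among representatives, so each of them is compared with
    [hinv]. Applying h to w = H_mu(hinv w) gives h w = hinv w as soon as h inverts H_mu at hinv w, a
    point of the slightly wider sector alpha'. *)
Lemma rectHinv_unique (h : C -> C) : is_rectHinv lambda mu h -> germ_eq h hinv.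
Proof.
move=> [_ _ _ hH] alpha ha; have /andP[a0 api] := ha.
pose alpha' := (alpha + pi) / 2.
have aa' : alpha < alpha' by rewrite /alpha'; lra.
have ha' : 0 < alpha' < pi by rewrite /alpha'; apply/andP; split; lra.
have [d d0 dP] := sector_perturb ha ha' aa'.
have [b1 b10 b1P] := rectH_hinv ha.
have [b3 b30 b3P] := hH _ ha'.
have e0 : 0 < Num.min d 1 by rewrite lt_min d0 ltr01.
have [b2 /andP[b20 _] b2P] := hinv_small G hl ha e0.
exists (Num.min b1 (Num.min b2 (b3 / 2))); first by rewrite !lt_min b10 b20 divr_gt0.
move=> w [wa /andP[w0]]; rewrite !lt_min => /and3P[wb1 wb2 wb3].
have ws : sector alpha w by split => //; rewrite -cmod_gt0.
have [hw qw _] := b2P w ws wb2.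
have wN0 : w != 0 by rewrite -cmod_gt0.
have z0 : hinv w != 0 by rewrite mulf_neq0// invr_eq0.
have qd : cmod ((hden w)^-1 - 1) <= d by apply: le_trans qw _; rewrite ge_min lexx.
have q1 : cmod ((hden w)^-1 - 1) <= 1 by apply: le_trans qw _;
  rewrite ge_min lexx orbT.
have zD : Delta alpha' b3 (hinv w).
  split; first exact: dP.
  rewrite cmod_gt0 z0 /=.
  have : cmod (hinv w) <= 2 * cmod w.
    by rewrite cmodM mulrC ler_wpM2r ?cmod_ge0// cmod_le2.
  lra.
have wH : rectH lambda mu (hinv w) = w by apply: b1P; split; rewrite ?w0.
by rewrite -[in LHS]wH; exact: b3P.
Qed.

Lemma sqrtc_sqr (x : C) : 0 < complex.Re x -> sqrtc (x ^+ 2) = x.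
Proof.
move=> x0; have Re0 (y : C) : 0 <= complex.Re (sqrtc y).
  by rewrite /sqrtc; case: y => a b /=; rewrite sqrtr_ge0.
have : sqrtc (x ^+ 2) ^+ 2 == x ^+ 2 by rewrite sqr_sqrtc.
rewrite eqf_sqr => /orP[/eqP //|/eqP h].
by have := Re0 (x ^+ 2); rewrite h ReN oppr_ge0 leNgt x0.
Qed.

(** The radicand is the perfect square (1 + lambda + 2 lambda C)^2, and |C| <= 1/4 keeps its root in
    the right half-plane, where the principal branch finds it. *)
Lemma rectU_hden (z : C) : cmod (levyC G z) <= 1 / 4 ->
  rectU lambda (hden z - 1) = levyC G z.
Proof.
move=> Cz; rewrite /rectU /levy_hden /mtilde; have [->|l0] := eqVneq lambda 0.
  by rewrite subr0 rmorph0 mul0r add0r rmorph1 mulr1 addrAC subrr add0r.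
have /andP[lp l1] := hl.
move: Cz; set K := levyC G z => Cz.
have -> : (lambda%:C + 1) ^+ 2 + 4 * lambda%:C *
   ((1 + K) * (lambda%:C * (1 + K) + (1 - lambda)%:C) - 1)
   = (2 * lambda%:C * K + lambda%:C + 1) ^+ 2.
  by rewrite rmorphB rmorph1 /=; ring.
have lN0 : lambda%:C != 0 :> C by rewrite -cmod_gt0 cmodR normr_gt0.
rewrite /sqrt_pos sqrtc_sqr; first by field.
have -> : 2 * lambda%:C * K + lambda%:C + 1 = (2 * lambda)%:C * K + (lambda + 1)%:C.
  by rewrite rmorphM rmorph_nat rmorphD rmorph1 addrA.
have -> : complex.Re ((2 * lambda)%:C * K + (lambda + 1)%:C) = 2 * lambda *
  complex.Re K + (lambda + 1).
  by case: (K) => a b /=; rewrite mul0r subr0.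
have : - (1 / 4) <= complex.Re K.
  by have := le_trans (ler_Re_cmod K) Cz; rewrite ler_norml => /andP[].
move: (complex.Re K) => x hx.
have : 2 * lambda * (- (1 / 4)) <= 2 * lambda * x by rewrite ler_wpM2l// mulr_ge0.
lra.
Qed.

Lemma rectC_levyC : germ_eq (rectC lambda mu) (levyC G).
Proof.
have hP : is_rectHinv lambda mu (rectHinv lambda mu).
  by apply: (@xgetPex _ (fun=> 0) [set h | is_rectHinv lambda mu h]);
    exists hinv; exact: hinv_is_rectHinv.
move=> alpha ha.
have [b1 b10 b1P] := rectHinv_unique hP ha.
have e0 : 0 < 1 / 4 :> R by rewrite divr_gt0.
have [b2 /andP[b20 _] b2P] := hinv_small G hl ha e0.
exists (Num.min b1 b2); first by rewrite lt_min b10.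
move=> z [za /andP[z0]]; rewrite lt_min => /andP[zb1 zb2].
have zN0 : z != 0 by rewrite -cmod_gt0.
have zs : sector alpha z by split.
have [hz _ Cz] := b2P z zs zb2.
rewrite /rectC b1P; last by split; rewrite ?z0.
rewrite /levy_hinv invfM invrK mulrA divff// mul1r.
exact: rectU_hden.
Qed.

End RectangularTransform.

(** * Infinite divisibility *)

Section InfinitelyDivisible.
Variable R : realType.
Local Notation C := R[i].
Local Notation RB := (measurableTypeR R).
Variable lambda : R.
Hypothesis hl : 0 <= lambda <= 1.

Lemma levy_law_exists (G : {finite_measure set RB -> \bar R}) :
  exists mu : probability RB R,
    symmetric_measure mu /\ germ_eq (rectC lambda mu) (levyC G).
Proof.
by have [mu smu muP] := levy_law G hl; exists mu; split => //; exact: rectC_levyC.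
Qed.

(** Scaling of the measure is first used for the nonnegative f + M; the constant is then subtracted
    on both sides. *)
Lemma Rintegral_mscale (G : {finite_measure set RB -> \bar R}) (k : {nonneg R})
    (f : RB -> R) (M : R) : measurable_fun [set: RB] f -> (forall t, `|f t| <= M) ->
  \int[mscale k G]_t f t = k%:num * \int[G]_t f t.
Proof.
move=> mf fM.
have shift (nu : {finite_measure set RB -> \bar R}) :
    \int[nu]_t (f t + M) = \int[nu]_t f t + M * fine (nu [set: RB]).
  rewrite RintegralD//; first by rewrite Rintegral_cst.
  - exact: bounded_integrable mf fM.
  - exact: finite_measure_integrable_cst.
have pos t : 0 <= f t + M by rewrite -lerBlDr sub0r lerNnormlW.
have mfM : measurable_fun [set: RB] (fun t => (f t + M)%:E).
  by apply/measurable_EFinP; exact: measurable_funD.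
have : \int[mscale k G]_t (f t + M) = k%:num * \int[G]_t (f t + M).
  rewrite {1}/Rintegral ge0_integral_mscale//; last by move=> t _; rewrite lee_fin.
  rewrite fineM//; apply: integrable_fin_num => //.
  apply: (@bounded_integrable _ _ _ (M + `|M|)); first exact: measurable_funD.
  by move=> t; rewrite (le_trans (ler_normD _ _))// lerD2r.
rewrite !shift.
have -> : fine (mscale k G [set: RB]) = k%:num * fine (G [set: RB]).
  by rewrite /mscale fineM//; exact: fin_num_measure.
by move=> h; apply: (@addIr _ (M * (k%:num * fine (G [set: RB])))); rewrite h; ring.
Qed.

Lemma levyC_mscale (G : {finite_measure set RB -> \bar R}) (k : {nonneg R}) :
  near0_sectors (fun z => levyC (mscale k G) z = k%:num%:C * levyC G z).
Proof.
move=> alpha ha; exists 1 => // z /Delta_sector[zs /andP[z0 _]].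
have [msq sq0 _] := approx_sqr_sqr R; have /andP[c0 _] := sector_cst01 ha.
have [[mr mi] [M fM]] := cbounded_levyD msq sq0 c0 z0 (sector_cone ha zs).
rewrite /levyC mulrCA; congr (_ * _); rewrite /cintegral.
have bRe t : `|complex.Re ((1 + t ^+ 2)%:C / (1 - z * (t ^+ 2)%:C))| <= M.
  exact: le_trans (ler_Re_cmod _) (fM t).
have bIm t : `|complex.Im ((1 + t ^+ 2)%:C / (1 - z * (t ^+ 2)%:C))| <= M.
  exact: le_trans (ler_Im_cmod _) (fM t).
rewrite (Rintegral_mscale G k mr bRe) (Rintegral_mscale G k mi bIm).
by apply/eqP; rewrite eq_complex /= !mul0r subr0 addr0 !eqxx.
Qed.

Lemma near0_sectorsS2 (P Q S : C -> Prop) : (forall z, P z -> Q z -> S z) ->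
  near0_sectors P -> near0_sectors Q -> near0_sectors S.
Proof.
move=> PQS hP hQ alpha ha; have [b1 b10 b1P] := hP _ ha;
  have [b2 b20 b2P] := hQ _ ha.
exists (Num.min b1 b2); first by rewrite lt_min b10.
move=> z [za /andP[z0]]; rewrite lt_min => /andP[zb1 zb2].
by apply: PQS; [apply: b1P|apply: b2P]; split; rewrite ?z0.
Qed.

Lemma levy_law_scaled (G : {finite_measure set RB -> \bar R}) (k : R) : 0 <= k ->
  exists mu : probability RB R, symmetric_measure mu /\
    germ_eq (rectC lambda mu) (fun z => k%:C * levyC G z).
Proof.
move=> k0; have [mu [smu muE]] := levy_law_exists (mscale (NngNum k0) G).
exists mu; split => //.
by apply: near0_sectorsS2 muE (levyC_mscale G (NngNum k0)) => z -> ->.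
Qed.

Lemma is_rect_conv_germ (G : {finite_measure set RB -> \bar R}) (a b : R)
    (mu nu rho : probability RB R) :
  symmetric_measure mu -> symmetric_measure nu -> symmetric_measure rho ->
  germ_eq (rectC lambda mu) (fun z => a%:C * levyC G z) ->
  germ_eq (rectC lambda nu) (fun z => b%:C * levyC G z) ->
  germ_eq (rectC lambda rho) (fun z => (a + b)%:C * levyC G z) ->
  is_rect_conv lambda mu nu rho.
Proof.
move=> smu snu srho muE nuE rhoE; split => //.
apply: (near0_sectorsS2 _ rhoE (near0_sectorsS2 (fun z h1 h2 => conj h1 h2) muE
  nuE)).
by move=> z -> [-> ->]; rewrite rmorphD mulrDl.
Qed.

Lemma rect_infinitely_divisible_levy (G : {finite_measure set RB -> \bar R})
    (mu : probability RB R) : symmetric_measure mu ->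
  germ_eq (rectC lambda mu) (levyC G) -> rect_infinitely_divisible lambda mu.
Proof.
move=> smu muE; split => // -[//|n] _.
have muE1 k : k = 1 -> germ_eq (rectC lambda mu) (fun z => k%:C * levyC G z).
  by move=> ->; apply: (near0_sectorsS2 _ muE muE) => z -> _; rewrite rmorph1 mul1r.
case: n => [|n].
  by exists mu; split => //; exact: rect_conv_pow1.
pose k : R := n.+2%:R^-1; have k0 : 0 <= k by rewrite invr_ge0.
have [nu [snu nuE]] := levy_law_scaled G k0.
exists nu; split => //.
have chain j : exists rho : probability RB R, [/\ is_rect_conv_pow lambda nu j.+1
  rho,
    symmetric_measure rho & germ_eq (rectC lambda rho) (fun z => (j.+1%:R * k)%:C
      * levyC G z)].
  elim: j => [|j [rho [pow srho rhoE]]].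
    by exists nu; split => //; [exact: rect_conv_pow1|rewrite mul1r].
  have jk : 0 <= j.+2%:R * k by rewrite mulr_ge0.
  have [sigma [ssigma sigmaE]] := levy_law_scaled G jk.
  exists sigma; split => //; apply: rect_conv_powS pow _.
  apply: (is_rect_conv_germ srho snu ssigma rhoE nuE).
  by rewrite -[X in _ + X]mul1r -mulrDl natr1.
(* [chain n] stops one factor short of n.+2. The last convolution is made to land on [mu], so that
   the power is [mu] itself and not merely a law with the same transform. *)
have [rho [pow srho rhoE]] := chain n.
apply: rect_conv_powS pow _; apply: (is_rect_conv_germ srho snu smu rhoE nuE).
by apply: muE1; rewrite -[X in _ + X]mul1r -mulrDl natr1 divff.
Qed.

End InfinitelyDivisible.

Theorem theorem2p6 (R : realType) (lambda : R) (hlambda : 0 <= lambda <= 1)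
    (G : {finite_measure set (measurableTypeR R) -> \bar R})
    (hG : symmetric_measure G) :
  exists mu : probability (measurableTypeR R) R,
    rect_infinitely_divisible lambda mu /\ is_levy_measure lambda mu G.
Proof.
have [mu [smu muE]] := levy_law_exists hlambda G.
by exists mu; split; [exact: rect_infinitely_divisible_levy muE|split].
Qed.
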